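(* Let $p,q\geq 2$ be integers. Then $B_{pq-1}(p\times q)$ is a free group of rank $(p-1)(q-1)$. Indeed, the space $\mathrm{UC}(pq-1,p\times q)$ is homotopy equivalent to a wedge of $(p-1)(q-1)$ circles.
   Context: For positive integers $n,p,q$, the space $\mathrm{UC}(n,p\times q)$ is the configuration space of $n$ unlabelled non-overlapping (axis-parallel) unit squares in a $p\times q$ rectangle. That is, $\mathrm{UC}(n,p\times q)=\mathrm{C}(n,p\times q)/\Sigma_n$, where $\mathrm{C}(n,p\times q)\subset(\mathbb{R}^2)^n$ is the space of tuples of centers $((x_1,y_1),\ldots,(x_n,y_n))$ with $\tfrac12\le x_k\le p-\tfrac12$ and $\tfrac12\le y_k\le q-\tfrac12$ for all $k$, and $\max(|x_k-x_\ell|,|y_k-y_\ell|)\ge 1$ for all $k\ne\ell$; the symmetric group $\Sigma_n$ acts by permuting labels. $B_n(p\times q):=\pi_1(\mathrm{UC}(n,p\times q))$ denotes its fundamental group. *)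

(* Defs.v *)
From HB Require Import structures.
From mathcomp Require Import all_boot all_order all_algebra all_fingroup.
From mathcomp Require Import generic_quotient.
From mathcomp Require Import all_classical all_reals all_analysis.
From mathcomp Require Import homotopy ring lra.

Set Implicit Arguments.
Unset Strict Implicit.
Unset Printing Implicit Defensive.

Import Order.TTheory GRing.Theory Num.Theory.
Import numFieldNormedType.Exports.

Local Open Scope classical_set_scope.
Local Open Scope ring_scope.

Definition unitI (R : realType) : Type := set_type `[0 : R, 1]%classic.

HB.instance Definition _ (R : realType) := Topological.on (unitI R).

Section unit_interval.
Context {R : realType}.

Definition uval (t : unitI R) : R := set_val t.

Let clampR (x : R) : R := Num.max 0 (Num.min 1 x).

Lemma clamp_subproof (x : R) : clampR x \in `[0 : R, 1]%classic.
Proof.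
rewrite inE /= in_itv /= /clampR le_max lexx /= ge_max ler01 /=.
by rewrite ge_min lexx.
Qed.

Definition clamp (x : R) : unitI R := exist _ (clampR x) (clamp_subproof x).

Lemma uvalP (t : unitI R) : 0 <= uval t <= 1.
Proof. by have := set_valP t; rewrite /= in_itv. Qed.

Lemma clampK (x : R) : 0 <= x <= 1 -> uval (clamp x) = x.
Proof.
move=> /andP[x0 x1]; rewrite /uval /clamp set_valE /= /clampR.
by rewrite min_r // max_r.
Qed.

Lemma uval_inj : injective uval.
Proof. by move=> s t; rewrite /uval set_valE; exact: val_inj. Qed.

Lemma uvalK : cancel uval clamp.
Proof. by move=> t; apply: uval_inj; rewrite clampK // uvalP. Qed.

Lemma uval_continuous : continuous uval.
Proof. exact: (@initial_continuous (unitI R) R set_val). Qed.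

Lemma clamp_continuous : continuous clamp.
Proof.
apply: (@continuous_comp_initial (unitI R) R R set_val).
move=> x; apply: continuous_max; first exact: cvg_cst.
by apply: continuous_min; [exact: cvg_cst|exact: cvg_id].
Qed.

Lemma clamp_le0 (x : R) : x <= 0 -> clamp x = clamp 0.
Proof.
move=> x0; apply: val_inj; rewrite /= /clampR min_r ?(le_trans x0) //.
by rewrite max_l // min_r ?max_l.
Qed.

Lemma clamp_ge1 (x : R) : 1 <= x -> clamp x = clamp 1.
Proof. by move=> x1; apply: val_inj; rewrite /= /clampR !min_l. Qed.

Lemma unitI_neq : clamp 0 != clamp 1.
Proof.
apply/eqP => /(congr1 uval); rewrite !clampK ?lexx ?ler01 //.
by move/eqP; rewrite eq_sym oner_eq0.
Qed.

End unit_interval.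

HB.instance Definition _ (R : realType) :=
  @isBiPointed.Build (unitI R) (clamp 0) (clamp 1) unitI_neq.

Section pasting.
Context {R : realType}.

Lemma paste_continuous (Z T : topologicalType) (u : Z -> R) (c : R)
    (f g : Z -> T) :
  continuous u -> continuous f -> continuous g ->
  (forall z, u z = c -> f z = g z) ->
  continuous (fun z => if u z <= c then f z else g z).
Proof.
move=> cu cf cg fg; set h := fun z => _.
have cA : closed (u @^-1` [set x | x <= c]).
  by apply: closed_comp => [? _|]; [exact: cu|exact: closed_le].
have cB : closed (u @^-1` [set x | c <= x]).
  by apply: closed_comp => [? _|]; [exact: cu|exact: closed_ge].
have hA : {within u @^-1` [set x | x <= c], continuous h}.
  apply: (subspace_eq_continuous (f := f)); last exact: continuous_subspaceT.
  by move=> z; rewrite inE /= => zc; rewrite /from_subspace /h zc.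
have hB : {within u @^-1` [set x | c <= x], continuous h}.
  apply: (subspace_eq_continuous (f := g)); last exact: continuous_subspaceT.
  move=> z; rewrite inE /= => cz; rewrite /from_subspace /h.
  by case: ifP => // zc; apply/esym/fg/le_anti; rewrite zc cz.
have := withinU_continuous cA cB hA hB.
rewrite (_ : _ `|` _ = setT); last first.
  by apply/seteqP; split=> // z _ /=; have [|/ltW] := leP (u z) c; [left|right].
by move=> ch; apply/continuous_subspace_setT.
Qed.

End pasting.

(* Free homotopy of maps; the homotopy parameter is the second coordinate. *)
Definition homotopic (R : realType) (X Y : topologicalType) (f g : X -> Y) :=
  exists H : X * unitI R -> Y,
    [/\ continuous H, (forall x, H (x, zero) = f x) &
      (forall x, H (x, one) = g x)].

Definition homotopy_equivalent (R : realType) (X Y : topologicalType) :=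
  exists (f : X -> Y) (g : Y -> X),
    [/\ continuous f, continuous g,
      homotopic R (g \o f) idfun & homotopic R (f \o g) idfun].

Section path_homotopy.
Context {R : realType} {T : topologicalType}.
Local Notation I := (unitI R).

Definition path_homotopic {x y : T} (a b : {path I from x to y}) :=
  exists H : I * I -> T,
    [/\ continuous H,
      (forall t, H (t, zero) = a t), (forall t, H (t, one) = b t),
      (forall s, H (zero, s) = x) & (forall s, H (one, s) = y)].

Lemma uval0 : uval (zero : I) = 0.
Proof. by rewrite clampK // lexx ler01. Qed.

Lemma uval1 : uval (one : I) = 1.
Proof. by rewrite clampK // lexx ler01. Qed.

Lemma fst_cont (X Y : topologicalType) : continuous (@fst X Y).
Proof. by move=> z; exact: cvg_fst. Qed.

Lemma snd_cont (X Y : topologicalType) : continuous (@snd X Y).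
Proof. by move=> z; exact: cvg_snd. Qed.

Lemma comp_cont (X Y Z : topologicalType) (g : Y -> Z) (f : X -> Y) :
  continuous g -> continuous f -> continuous (fun x => g (f x)).
Proof. by move=> cg cf x; apply: continuous_comp; [exact: cf|exact: cg]. Qed.

Lemma pair_cont (X Y Z : topologicalType) (f : X -> Y) (g : X -> Z) :
  continuous f -> continuous g -> continuous (fun x => (f x, g x)).
Proof. by move=> cf cg x; apply: cvg_pair; [exact: cf|exact: cg]. Qed.

Lemma affine_cont (X : topologicalType) (u : X -> R) (m c : R) :
  continuous u -> continuous (fun x => m * u x + c).
Proof.
by move=> cu x; apply: cvgD; [apply: cvgM; [exact: cvg_cst|exact: cu]|
  exact: cvg_cst].
Qed.

Lemma onem_cont (X : topologicalType) (u : X -> R) :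
  continuous u -> continuous (fun x => 1 - u x).
Proof.
move=> cu; rewrite (_ : (fun x => _) = fun x => -1 * u x + 1).
  exact: affine_cont.
by apply/funext => x; rewrite mulN1r addrC.
Qed.

Lemma min_cont (X : topologicalType) (u v : X -> R) :
  continuous u -> continuous v -> continuous (fun x => Num.min (u x) (v x)).
Proof.
by move=> cu cv x; apply: (@continuous_min R X u v x); [exact: cu|exact: cv].
Qed.

Lemma max_cont (X : topologicalType) (u v : X -> R) :
  continuous u -> continuous v -> continuous (fun x => Num.max (u x) (v x)).
Proof.
by move=> cu cv x; apply: (@continuous_max R X u v x); [exact: cu|exact: cv].
Qed.

Definition aff (m c : R) (t : I) : I := clamp (m * uval t + c).

Lemma aff_cont m c : continuous (aff m c).
Proof.
by apply: comp_cont; [exact: clamp_continuous|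
  apply: affine_cont; exact: uval_continuous].
Qed.

Lemma path_homotopic_refl {x y : T} (a : {path I from x to y}) :
  path_homotopic a a.
Proof.
exists (fun z => a z.1); split => // [|s|s]; rewrite ?path_zero ?path_one //.
by apply: comp_cont; [exact: cts_fun|exact: fst_cont].
Qed.

Lemma path_homotopic_sym {x y : T} (a b : {path I from x to y}) :
  path_homotopic a b -> path_homotopic b a.
Proof.
move=> [H [cH Ha Hb Hx Hy]].
exists (fun z => H (z.1, aff (-1) 1 z.2)); split => // [|t|t].
- apply: comp_cont => //; apply: pair_cont; first exact: fst_cont.
  by apply: comp_cont; [exact: aff_cont|exact: snd_cont].
- by rewrite /aff uval0 mulr0 add0r -Hb.
- by rewrite /aff uval1 mulr1 addNr -Ha.
Qed.

Lemma half01 : (0 <= (2^-1 : R) <= 1) /\ 2 * (2^-1 : R) = 1.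
Proof. split; lra. Qed.

Lemma path_homotopic_trans {x y : T} (a b c : {path I from x to y}) :
  path_homotopic a b -> path_homotopic b c -> path_homotopic a c.
Proof.
move=> [H [cH Ha Hb Hx Hy]] [K [cK Kb Kc Kx Ky]].
exists (fun z => if uval z.2 <= 2^-1 then H (z.1, aff 2 0 z.2)
                 else K (z.1, aff 2 (-1) z.2)); split => [|t|t|s|s].
- apply: paste_continuous.
  + by apply: comp_cont; [exact: uval_continuous|exact: snd_cont].
  + apply: comp_cont => //; apply: pair_cont; first exact: fst_cont.
    by apply: comp_cont; [exact: aff_cont|exact: snd_cont].
  + apply: comp_cont => //; apply: pair_cont; first exact: fst_cont.
    by apply: comp_cont; [exact: aff_cont|exact: snd_cont].
  + move=> [t s] /= us; rewrite /aff us half01.2 addr0 subrr.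
    by rewrite -[clamp 1]/one -[clamp 0]/zero Hb Kb.
- rewrite /= uval0 ifT ?invr_ge0 ?ler0n // /aff uval0 mulr0 addr0.
  by rewrite -[clamp 0]/zero Ha.
- rewrite /= uval1 ifF; last by apply/negbTE; rewrite -ltNge; lra.
  rewrite /aff uval1 (_ : 2 * 1 + -1 = 1); last by lra.
  by rewrite -[clamp 1]/one Kc.
- by rewrite /=; case: ifP.
- by rewrite /=; case: ifP.
Qed.

Lemma reparam_homotopic {x y : T} (p : I -> T) (f g : I -> I)
    (a b : {path I from x to y}) :
  continuous p -> continuous f -> continuous g ->
  f zero = g zero -> f one = g one -> a =1 p \o f -> b =1 p \o g ->
  path_homotopic a b.
Proof.
move=> cp cf cg fg0 fg1 af bg.
exists (fun z => p (clamp ((1 - uval z.2) * uval (f z.1)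
                            + uval z.2 * uval (g z.1)))).
have line (u s : R) : (1 - s) * u + s * u = u by ring.
split => [|t|t|s|s] /=.
- apply: comp_cont => //; apply: comp_cont; first exact: clamp_continuous.
  have c2 : continuous (fun z : I * I => uval z.2).
    by apply: comp_cont; [exact: uval_continuous|exact: snd_cont].
  have cz (h : I -> I) : continuous h -> continuous (fun z : I * I => uval (h z.1)).
    move=> ch; apply: comp_cont; first exact: uval_continuous.
    by apply: comp_cont => //; exact: fst_cont.
  move=> z; apply: cvgD; apply: cvgM.
  + exact: (onem_cont c2).
  + exact: (cz f cf).
  + exact: c2.
  + exact: (cz g cg).
- by rewrite uval0 subr0 mul1r mul0r addr0 uvalK af.
- by rewrite uval1 subrr mul0r mul1r add0r uvalK bg.
- by rewrite fg0 line uvalK -fg0 -[LHS]/((p \o f) zero) -af path_zero.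
- by rewrite fg1 line uvalK -fg1 -[LHS]/((p \o f) one) -af path_one.
Qed.

Section concatenation.
Context {x y z : T} (a : {path I from x to y}) (b : {path I from y to z}).

Definition concat_fun (t : I) : T :=
  if uval t <= 2^-1 then a (clamp (2 * uval t)) else b (clamp (2 * uval t - 1)).

Lemma concat_fun_cont : continuous concat_fun.
Proof.
apply: paste_continuous; first exact: uval_continuous.
- apply: comp_cont; first exact: cts_fun.
  apply: comp_cont; first exact: clamp_continuous.
  have := @affine_cont I _ 2 0 uval_continuous.
  by under eq_fun do rewrite addr0.
- apply: comp_cont; first exact: cts_fun.
  apply: comp_cont; first exact: clamp_continuous.
  exact: (@affine_cont I _ 2 (-1) uval_continuous).
- move=> t ->; rewrite half01.2 subrr -[clamp 1]/one -[clamp 0]/zero.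
  by rewrite path_one path_zero.
Qed.

Lemma concat_fun0 : concat_fun zero = x.
Proof.
rewrite /concat_fun uval0 mulr0 ifT ?invr_ge0 ?ler0n //.
by rewrite -[clamp 0]/zero path_zero.
Qed.

Lemma concat_fun1 : concat_fun one = z.
Proof.
rewrite /concat_fun uval1 ifF; last by apply/negbTE; rewrite -ltNge; lra.
by rewrite (_ : 2 * 1 - 1 = 1) ; [rewrite -[clamp 1]/one path_one|lra].
Qed.

Definition path_concat : {path I from x to z} :=
  mk_path concat_fun_cont concat_fun0 concat_fun1.

End concatenation.

Section reversal.
Context {x y : T} (a : {path I from x to y}).

Definition reverse_fun (t : I) : T := a (clamp (1 - uval t)).

Lemma reverse_fun_cont : continuous reverse_fun.
Proof.
apply: (comp_cont (g := a)); first exact: cts_fun.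
apply: (comp_cont (g := clamp)); first exact: clamp_continuous.
by apply: onem_cont; exact: uval_continuous.
Qed.

Lemma reverse_fun0 : reverse_fun zero = y.
Proof. by rewrite /reverse_fun uval0 subr0 -[clamp 1]/one path_one. Qed.

Lemma reverse_fun1 : reverse_fun one = x.
Proof. by rewrite /reverse_fun uval1 subrr -[clamp 0]/zero path_zero. Qed.

Definition path_reverse : {path I from y to x} :=
  mk_path reverse_fun_cont reverse_fun0 reverse_fun1.

End reversal.

Definition path_const (x : T) : {path I from x to x} := cst x.

Lemma path_concat_homotopic {x y z : T} (a a' : {path I from x to y})
    (b b' : {path I from y to z}) :
  path_homotopic a a' -> path_homotopic b b' ->
  path_homotopic (path_concat a b) (path_concat a' b').
Proof.
move=> [H [cH Ha Ha' Hx Hy]] [K [cK Kb Kb' Ky Kz]].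
exists (fun w => if uval w.1 <= 2^-1 then H (aff 2 0 w.1, w.2)
                 else K (aff 2 (-1) w.1, w.2)); split => [|t|t|s|s] /=.
- apply: paste_continuous.
  + by apply: comp_cont; [exact: uval_continuous|exact: fst_cont].
  + apply: comp_cont => //; apply: pair_cont; last exact: snd_cont.
    by apply: comp_cont; [exact: aff_cont|exact: fst_cont].
  + apply: comp_cont => //; apply: pair_cont; last exact: snd_cont.
    by apply: comp_cont; [exact: aff_cont|exact: fst_cont].
  + move=> [t s] /= ut; rewrite /aff ut half01.2 addr0 subrr.
    by rewrite -[clamp 1]/one -[clamp 0]/zero Hy Ky.
- by rewrite /mk_path /concat_fun /aff addr0 Ha Kb.
- by rewrite /mk_path /concat_fun /aff addr0 Ha' Kb'.
- rewrite uval0 ifT ?invr_ge0 ?ler0n // /aff uval0 mulr0 addr0.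
  by rewrite -[clamp 0]/zero Hx.
- rewrite uval1 ifF; last by apply/negbTE; rewrite -ltNge; lra.
  rewrite /aff uval1 (_ : 2 * 1 + -1 = 1); last by lra.
  by rewrite -[clamp 1]/one Kz.
Qed.

Lemma path_reverse_homotopic {x y : T} (a b : {path I from x to y}) :
  path_homotopic a b -> path_homotopic (path_reverse a) (path_reverse b).
Proof.
move=> [H [cH Ha Hb Hx Hy]].
exists (fun w => H (clamp (1 - uval w.1), w.2)); split => [|t|t|s|s] /=.
- apply: comp_cont => //; apply: pair_cont; last exact: snd_cont.
  apply: (@comp_cont _ _ _ (fun t => clamp (1 - uval t)) fst).
    apply: comp_cont; first exact: clamp_continuous.
    by apply: onem_cont; exact: uval_continuous.
  exact: fst_cont.
- by rewrite Ha.
- by rewrite Hb.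
- by rewrite uval0 subr0 -[clamp 1]/one Hy.
- by rewrite uval1 subrr -[clamp 0]/zero Hx.
Qed.

Local Ltac case_minmax := repeat match goal with
  | |- context [Order.min ?u ?v] =>
    lazymatch v with context [Order.min _ _] => fail | _ => case: (leP u v) => ? end
  | |- context [Order.max ?u ?v] => case: (leP u v) => ?
  end.

Lemma path_concatA {x y z w : T} (a : {path I from x to y})
    (b : {path I from y to z}) (c : {path I from z to w}) :
  path_homotopic (path_concat a (path_concat b c))
                 (path_concat (path_concat a b) c).
Proof.
apply: path_homotopic_sym.
pose f t : I := clamp (Num.min (2 * uval t)
  (Num.min (uval t + 4^-1) (2^-1 * uval t + 2^-1))).
apply: (@reparam_homotopic _ _ (path_concat a (path_concat b c)) f id).
- exact: cts_fun.
- apply: comp_cont; first exact: clamp_continuous.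
  have c2 := @affine_cont I _ 2 0 (@uval_continuous R).
  have c1 := @affine_cont I _ 1 4^-1 (@uval_continuous R).
  have ch := @affine_cont I _ 2^-1 2^-1 (@uval_continuous R).
  apply: min_cont.
    by move: c2; under eq_fun do rewrite addr0.
  apply: min_cont; last exact: ch.
  by move: c1; under eq_fun do rewrite mul1r.
- by move=> ?; exact: cvg_id.
- by rewrite /f uval0 -[RHS]uvalK uval0; congr clamp; case_minmax; lra.
- by rewrite /f uval1 -[RHS]uvalK uval1; congr clamp; case_minmax; lra.
- move=> t /=; rewrite /mk_path.
  have ft : uval (f t) = Num.min (2 * uval t)
      (Num.min (uval t + 4^-1) (2^-1 * uval t + 2^-1)).
    rewrite clampK //; have /andP[t0 t1] := uvalP t.
    by case_minmax; apply/andP; split; lra.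
  have /andP[t0 t1] := uvalP t.
  rewrite /concat_fun /= /mk_path.
  have [t2|t2] := leP (uval t) 2^-1.
    rewrite /concat_fun clampK; last by apply/andP; split; lra.
    have [t4|t4] := leP (2 * uval t) 2^-1.
      have -> : uval (f t) = 2 * uval t by rewrite ft; case_minmax; lra.
      by rewrite t4.
    have -> : uval (f t) = uval t + 4^-1 by rewrite ft; case_minmax; lra.
    rewrite /= ifF; last by apply/negbTE; rewrite -ltNge; lra.
    rewrite clampK; last by apply/andP; split; lra.
    rewrite ifT; last lra.
    by congr (b (clamp _)); lra.
  have -> : uval (f t) = 2^-1 * uval t + 2^-1 by rewrite ft; case_minmax; lra.
  rewrite /concat_fun /= ifF; last by apply/negbTE; rewrite -ltNge; lra.
  rewrite clampK; last by apply/andP; split; lra.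
  rewrite ifF; last by apply/negbTE; rewrite -ltNge; lra.
  by congr (c (clamp _)); lra.
- by [].
Qed.

Lemma path_concat1l {x y : T} (a : {path I from x to y}) :
  path_homotopic (path_concat (path_const x) a) a.
Proof.
apply: (@reparam_homotopic _ _ a (aff 2 (-1)) id).
- exact: cts_fun.
- exact: aff_cont.
- by move=> ?; exact: cvg_id.
- by rewrite /aff uval0 clamp_le0 //; lra.
- by rewrite /aff uval1 clamp_ge1 //; lra.
- move=> t /=; rewrite /mk_path /concat_fun /aff; case: ifP => // t2.
  by rewrite [X in a X](_ : _ = zero) ?path_zero // clamp_le0 //; lra.
- by [].
Qed.

Lemma path_concat1r {x y : T} (a : {path I from x to y}) :
  path_homotopic (path_concat a (path_const y)) a.
Proof.
apply: (@reparam_homotopic _ _ a (aff 2 0) id).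
- exact: cts_fun.
- exact: aff_cont.
- by move=> ?; exact: cvg_id.
- by rewrite /aff uval0 clamp_le0 //; lra.
- by rewrite /aff uval1 clamp_ge1 //; lra.
- move=> t /=; rewrite /mk_path /concat_fun /aff addr0; case: ifP => // t2.
  move/negbT: t2; rewrite -ltNge => t2.
  by rewrite [X in a X](_ : _ = one) ?path_one // clamp_ge1 //; lra.
- by [].
Qed.

Lemma path_concatV {x y : T} (a : {path I from x to y}) :
  path_homotopic (path_concat a (path_reverse a)) (path_const x).
Proof.
pose f t : I := clamp (Num.min (2 * uval t + 0) (- 2 * uval t + 2)).
apply: (@reparam_homotopic _ _ a f (fun=> zero)).
- exact: cts_fun.
- apply: comp_cont; first exact: clamp_continuous.
  by apply: min_cont; apply: affine_cont; exact: uval_continuous.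
- exact: cst_continuous.
- by rewrite /f uval0 -[RHS]uvalK uval0; congr clamp; case_minmax; lra.
- by rewrite /f uval1 -[RHS]uvalK uval0; congr clamp; case_minmax; lra.
- move=> t /=; rewrite /mk_path /concat_fun /f /= /mk_path /reverse_fun.
  have /andP[t0 t1] := uvalP t; have [t2|t2] := leP (uval t) 2^-1.
    by congr (a (clamp _)); case_minmax; lra.
  rewrite clampK; last by apply/andP; split; lra.
  by congr (a (clamp _)); case_minmax; lra.
- by move=> t /=; rewrite path_zero.
Qed.

Lemma path_concatVl {x y : T} (a : {path I from x to y}) :
  path_homotopic (path_concat (path_reverse a) a) (path_const y).
Proof.
pose f t : I := clamp (Num.max (- 2 * uval t + 1) (2 * uval t - 1)).
apply: (@reparam_homotopic _ _ a f (fun=> one)).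
- exact: cts_fun.
- apply: comp_cont; first exact: clamp_continuous.
  by apply: max_cont; apply: affine_cont; exact: uval_continuous.
- exact: cst_continuous.
- by rewrite /f uval0 -[RHS]uvalK uval1; congr clamp; case_minmax; lra.
- by rewrite /f uval1 -[RHS]uvalK uval1; congr clamp; case_minmax; lra.
- move=> t /=; rewrite /mk_path /concat_fun /f /= /mk_path /reverse_fun.
  have /andP[t0 t1] := uvalP t; have [t2|t2] := leP (uval t) 2^-1.
    rewrite clampK; last by apply/andP; split; lra.
    by congr (a (clamp _)); case_minmax; lra.
  by congr (a (clamp _)); case_minmax; lra.
- by move=> t /=; rewrite path_one.
Qed.

End path_homotopy.

Section fundamental_group.
Context (R : realType) (T : topologicalType) (x : T).
Local Open Scope quotient_scope.
Local Notation loop := {path (unitI R) from x to x}.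

Let loop_rel (a b : loop) := `[< path_homotopic a b >].

Lemma loop_rel_refl : reflexive loop_rel.
Proof. by move=> a; apply/asboolP; exact: path_homotopic_refl. Qed.

Lemma loop_rel_sym : symmetric loop_rel.
Proof. by move=> a b; apply/asboolP/asboolP; exact: path_homotopic_sym. Qed.

Lemma loop_rel_trans : transitive loop_rel.
Proof.
move=> b a c /asboolP ab /asboolP bc; apply/asboolP.
exact: path_homotopic_trans ab bc.
Qed.

Definition loop_equiv := EquivRel _ loop_rel_refl loop_rel_sym loop_rel_trans.

Definition pi1 : Type := {eq_quot loop_equiv}.

HB.instance Definition _ := Choice.on pi1.
HB.instance Definition _ := Quotient.on pi1.

Definition loop_class (a : loop) : pi1 := \pi_({eq_quot loop_equiv}) a.

Lemma loop_classP (a b : loop) :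
  loop_class a = loop_class b <-> path_homotopic a b.
Proof. by split=> [/eqmodP/asboolP|ab]; [|apply/eqmodP/asboolP]. Qed.

Lemma loop_class_repr (u : pi1) : loop_class (repr u) = u.
Proof. exact: reprK. Qed.

Lemma repr_loop_class (a : loop) : path_homotopic (repr (loop_class a)) a.
Proof. by apply/loop_classP; rewrite loop_class_repr. Qed.

Definition pi1_one : pi1 := loop_class (path_const x).
Definition pi1_inv (u : pi1) : pi1 := loop_class (path_reverse (repr u)).
Definition pi1_mul (u v : pi1) : pi1 :=
  loop_class (path_concat (repr u) (repr v)).

Lemma pi1_mulE (a b : loop) :
  pi1_mul (loop_class a) (loop_class b) = loop_class (path_concat a b).
Proof. by apply/loop_classP/path_concat_homotopic; exact: repr_loop_class. Qed.

Lemma pi1_invE (a : loop) :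
  pi1_inv (loop_class a) = loop_class (path_reverse a).
Proof. by apply/loop_classP/path_reverse_homotopic; exact: repr_loop_class. Qed.

Lemma pi1_mulA : associative pi1_mul.
Proof.
move=> u v w; rewrite -[u]loop_class_repr -[v]loop_class_repr.
rewrite -[w]loop_class_repr !pi1_mulE; exact/loop_classP/path_concatA.
Qed.

Lemma pi1_mul1l : left_id pi1_one pi1_mul.
Proof.
move=> u; rewrite -[u]loop_class_repr pi1_mulE.
exact/loop_classP/path_concat1l.
Qed.

Lemma pi1_mul1r : right_id pi1_one pi1_mul.
Proof.
move=> u; rewrite -[u]loop_class_repr pi1_mulE.
exact/loop_classP/path_concat1r.
Qed.

Lemma pi1_mulVl : left_inverse pi1_one pi1_inv pi1_mul.
Proof.
move=> u; rewrite -[u]loop_class_repr pi1_invE pi1_mulE.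
exact/loop_classP/path_concatVl.
Qed.

Lemma pi1_mulVr : right_inverse pi1_one pi1_inv pi1_mul.
Proof.
move=> u; rewrite -[u]loop_class_repr pi1_invE pi1_mulE.
exact/loop_classP/path_concatV.
Qed.

HB.instance Definition _ := isGroup.Build pi1
  pi1_mulA pi1_mul1l pi1_mul1r pi1_mulVl pi1_mulVr.

End fundamental_group.

(* The universal property of the free group on b. *)
Definition is_free_basis (G : groupType) (B : Type) (b : B -> G) :=
  forall (H : groupType) (f : B -> H),
    (exists phi : {multiplicative G -> H}, forall i, phi (b i) = f i) /\
    (forall phi psi : {multiplicative G -> H},
      (forall i, phi (b i) = f i) -> (forall i, psi (b i) = f i) ->
      phi =1 psi).

Definition is_free_of_rank (G : groupType) (r : nat) :=
  exists b : 'I_r -> G, is_free_basis b.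

Section circles.
Context (R : realType).

Definition circle_set : set (R * R) := [set z | z.1 ^+ 2 + z.2 ^+ 2 = 1].

Lemma circle_base_subproof : (1, 0) \in circle_set.
Proof. by rewrite inE /circle_set /= expr1n expr0n addr0. Qed.

Definition circle : topologicalType := set_type circle_set.
Definition circle_base : circle := exist _ (1, 0) circle_base_subproof.

(* For r = 0 this wedge is the empty space rather than a point; it is only
   meant for r > 0. *)
Definition wedge_of_circles (r : nat) : topologicalType :=
  wedge (fun _ : 'I_r => circle_base).

End circles.

Section configurations.
Context (R : realType) (n p q : nat).
Local Open Scope quotient_scope.

(* The coordinates of c k are those of the centre of the k-th square. *)
Definition config_set : set {ptws 'I_n -> (R * R)%type} :=
  [set c | (forall k, 2^-1 <= (c k).1 <= p%:R - 2^-1 /\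
                      2^-1 <= (c k).2 <= q%:R - 2^-1) /\
           (forall k l, k != l ->
              1 <= Num.max `|(c k).1 - (c l).1| `|(c k).2 - (c l).2|)].

Definition config : topologicalType := set_type config_set.

Definition relabelled (c d : config) : bool :=
  [exists s : 'S_n, [forall k, set_val d k == set_val c (s k)]].

Lemma relabelled_refl : reflexive relabelled.
Proof.
by move=> c; apply/existsP; exists 1%g; apply/forallP => k; rewrite perm1.
Qed.

Lemma relabelled_sym : symmetric relabelled.
Proof.
suff sub c d : relabelled c d -> relabelled d c.
  by move=> c d; apply/idP/idP; exact: sub.
move=> /existsP[s /forallP cd]; apply/existsP; exists s^-1%g; apply/forallP => k.
by rewrite (eqP (cd _)) permKV.
Qed.

Lemma relabelled_trans : transitive relabelled.
Proof.
move=> d c e /existsP[s /forallP cd] /existsP[t /forallP de].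
apply/existsP; exists (t * s)%g; apply/forallP => k.
by rewrite (eqP (de _)) (eqP (cd _)) permM.
Qed.

Definition relabelling :=
  EquivRel _ relabelled_refl relabelled_sym relabelled_trans.

Definition UC : topologicalType := quotient_topology {eq_quot relabelling}.

End configurations.

(* The base point x is kept as a parameter: UC is not known a priori to be
   path-connected. *)
Definition braid_group (R : realType) (n p q : nat) (x : UC R n p q) :
  groupType := pi1 R x.

(* Main.v *)
(* Let a_k, b_k be the coordinates of the lower left corners of the squares.
   Rounding them (up or down, independently in each direction) sends the pq - 1
   squares injectively to the pq cells of the grid.  Comparing the cells missed
   by the four roundings shows that all the a_k or all the b_k are integers, so
   the squares are aligned in columns or in rows, and all the lines but one are
   full.  The weights w_c = 1 - sum_k tent (a_k - c.1) tent (b_k - c.2) then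
   identify UC(pq - 1, p x q) with the simplicial complex M on the cells of the
   grid whose maximal simplices are the rows and the columns.

   Any two maps to M whose values at each point lie on a common line are
   homotopic by a straight-line homotopy.  This gives both the homotopy
   equivalence of M with the wedge (a circle runs through an inner cell, along
   its row and its column) and, since M is locally star-shaped, the generation
   of its fundamental group by the loops of the inner cells.  These loops are
   free generators: a choice of an element of H for each cell, as the transition
   from its row to its column, is a locally constant cocycle, whose monodromy is
   a morphism from the fundamental group to H. *)

From HB Require Import structures.
From mathcomp Require Import all_boot all_order all_algebra all_fingroup.
From mathcomp Require Import generic_quotient.
From mathcomp Require Import all_classical all_reals all_analysis.
From mathcomp Require Import homotopy ring lra.
Require Import Defs.

Set Implicit Arguments.
Unset Strict Implicit.
Unset Printing Implicit Defensive.

Import Order.TTheory GRing.Theory Num.Theory.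
Import numFieldNormedType.Exports.

Local Open Scope classical_set_scope.
Local Open Scope ring_scope.

(** * Lifting along a local cocycle *)

(** Freeness is not deduced from the wedge. A free basis is defined by a universal property: for
    every group H, a morphism with prescribed values must exist and be unique. Both become local
    questions once morphisms are extended from loops to all paths; this replaces a van Kampen
    argument and works at any base point.

    The weights come from a row with a gap. Pushed to the left, its squares fill all cells but the
    last, and their true displacements satisfy 0 <= d_0 <= d_1 <= ... <= 1. These inequalities cut
    out a simplex, whose barycentric coordinates are the successive increments. The tent functions
    express the increments symmetrically in the squares and by one continuous formula, valid for
    rows and for columns.

    The squares are recovered from the weights only pointwise, by arbitrary choices: UC is compact
    and M is Hausdorff, so the inverse is automatically continuous. Column configurations are
    reduced to row configurations by exchanging the two coordinates. *)

Section lifting.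
Context {R : realType} {H : groupType}.
Local Notation I := (unitI R).

Definition is_cocycle_on (Z : Type) (c : Z -> Z -> H) (W : set Z) :=
  forall x y z, W x -> W y -> W z -> (c x y * c y z)%g = c x z.

Definition local_cocycle (Z : topologicalType) (c : Z -> Z -> H) :=
  forall z : Z, exists2 W, nbhs z W & is_cocycle_on c W.

Definition is_lift (Z : topologicalType) (c : Z -> Z -> H) (l : Z -> H) :=
  forall z : Z, exists2 V, nbhs z V &
    forall x y, V x -> V y -> ((l x)^-1 * l y)%g = c x y.

Lemma cocycle_refl (Z : Type) (c : Z -> Z -> H) W x :
  is_cocycle_on c W -> W x -> c x x = 1%g.
Proof.
move=> cW Wx; have /(congr1 (fun g => (c x x)^-1 * g)%g) := cW _ _ _ Wx Wx Wx.
by rewrite mulKg mulVg.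
Qed.

Lemma local_cocycle_comp (Y Z : topologicalType) (f : Y -> Z)
    (c : Z -> Z -> H) : continuous f -> local_cocycle c ->
  local_cocycle (fun x y => c (f x) (f y)).
Proof.
move=> cf cc y; have [W Wy cW] := cc (f y).
by exists (f @^-1` W); [exact: cf|move=> ? ? ?; exact: cW].
Qed.

Lemma is_lift_comp (Y Z : topologicalType) (f : Y -> Z)
    (c : Z -> Z -> H) l : continuous f -> is_lift c l ->
  is_lift (fun x y => c (f x) (f y)) (l \o f).
Proof.
move=> cf cc y; have [W Wy cW] := cc (f y).
by exists (f @^-1` W); [exact: cf|move=> ? ?; exact: cW].
Qed.

Lemma locally_constant_unitI (T : Type) (l : I -> T) :
  (forall t : I, exists2 V, nbhs t V & forall x y, V x -> V y -> l x = l y) ->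
  l zero = l one.
Proof.
move=> lc.
pose m (u : R) := l (clamp u).
have mc (u : R) : exists2 V, nbhs u V & forall x y, V x -> V y -> m x = m y.
  have [V Vu cV] := lc (clamp u).
  by exists (clamp @^-1` V); [exact: clamp_continuous|move=> ? ?; exact: cV].
have : connected `[0 : R, 1] by exact: segment_connected.
pose B : set R := [set u | m u = m 0].
have oB : open B.
  rewrite openE => u Bu; have [V Vu cV] := mc u.
  apply: filterS (Vu) => v Vv /=; rewrite /B /= -Bu; apply: cV => //.
  exact: nbhs_singleton.
have clB : closed B.
  move=> u clu; have [V Vu cV] := mc u.
  have [v [Bv Vv]] := clu _ Vu; rewrite /B /= -Bv; apply: cV => //.
  exact: nbhs_singleton.
have m0 : `[0 : R, 1]%classic 0 by rewrite /= in_itv /= lexx ler01.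
have m1 : `[0 : R, 1]%classic 1 by rewrite /= in_itv /= lexx ler01.
move=> /(_ (`[0, 1] `&` B)) h.
have : (`[0 : R, 1] `&` B) 1.
  rewrite h //; first by exists 0.
  - by exists B.
  - by exists B.
by move=> [_]; rewrite /B /m /=.
Qed.

(** Two lifts of one cocycle differ by a left factor that is locally constant, hence constant on the
    interval. *)
Lemma lift_unitI_unique (c : I -> I -> H) (l l' : I -> H) :
  is_lift c l -> is_lift c l' ->
  ((l zero)^-1 * l one = (l' zero)^-1 * l' one)%g.
Proof.
move=> ll ll'.
suff : (l zero * (l' zero)^-1 = l one * (l' one)^-1)%g.
  move=> /(congr1 (fun g => (l zero)^-1 * g * l' one)%g).
  by rewrite !mulgA mulVg mul1g mulgKV => ->.
apply: (@locally_constant_unitI _ (fun t => l t * (l' t)^-1)%g) => t.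
have [V Vt cV] := ll t; have [V' Vt' cV'] := ll' t.
exists (V `&` V'); first exact: filterI.
move=> x y [Vx V'x] [Vy V'y].
have := cV' x y V'x V'y; rewrite -cV // => e.
have -> : l y = (l x * (l' x)^-1 * l' y)%g by rewrite -mulgA e mulVKg.
by rewrite mulgK.
Qed.

(* The lift is the product of [c] along [N.+1] steps of the segment from the
   origin; neighbouring segments are compared rung by rung. *)
Section ladder.
Variables (c : R * R -> R * R -> H) (N : nat).
Let sc m (z : R * R) : R * R :=
  (m%:R / N.+1%:R * z.1, m%:R / N.+1%:R * z.2).
Let Fixpoint lad z m :=
  if m is m'.+1 then (lad z m' * c (sc m' z) (sc m z))%g else 1%g.

Lemma ladder_lift (z0 : R * R) :
  0 <= z0.1 <= 1 -> 0 <= z0.2 <= 1 ->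
  (forall z : R * R, 0 <= z.1 <= 1 -> 0 <= z.2 <= 1 -> exists2 W,
     is_cocycle_on c W & forall y, `|y.1 - z.1| <= 2 / N.+1%:R ->
       `|y.2 - z.2| <= 2 / N.+1%:R -> W y) ->
  exists2 V, nbhs z0 V &
    forall x y, V x -> V y -> ((lad x N.+1)^-1 * lad y N.+1)%g = c x y.
Proof.
move=> z01 z02 good.
have N0 : 0 < N.+1%:R :> R by rewrite ltr0n.
pose d : R := N.+1%:R^-1.
have d0 : 0 < d by rewrite invr_gt0.
have scle m z (u v : R) : (m <= N.+1)%N -> `|u - v| <= z ->
   `|m%:R / N.+1%:R * u - m%:R / N.+1%:R * v| <= z.
  move=> mN uv; rewrite -mulrBr normrM (le_trans _ uv) // ler_piMl //.
  rewrite ger0_norm ?divr_ge0 ?ler0n // ler_pdivrMr // mul1r ler_nat //.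
have sc01 m (u : R) : (m <= N.+1)%N -> 0 <= u <= 1 ->
    0 <= m%:R / N.+1%:R * u <= 1.
  move=> mN /andP[u0 u1].
  have a0 : 0 <= m%:R / N.+1%:R :> R by rewrite divr_ge0 ?ler0n.
  rewrite mulr_ge0 //= mulr_ile1 //.
  by rewrite ler_pdivrMr // mul1r ler_nat.
pose V : set (R * R) := [set x | `|x.1 - z0.1| <= d /\ `|x.2 - z0.2| <= d].
have main m x y : (m <= N.+1)%N -> V x -> V y ->
    (lad x m * c (sc m x) (sc m y) = lad y m)%g.
  move=> + [Vx1 Vx2] [Vy1 Vy2]; elim: m => [_|m IH mN].
    rewrite /= mul1g.
    have [|| W cW WW] := good (sc 0 x).
    - by rewrite /sc /= !mul0r lexx ler01.
    - by rewrite /sc /= !mul0r lexx ler01.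
    rewrite (_ : sc 0 y = sc 0 x); last by rewrite /sc !mul0r.
    apply: cocycle_refl cW _; apply: WW; rewrite subrr normr0 divr_ge0 //.
  have m1 : (m <= N.+1)%N by exact: ltnW.
  have [|| W cW WW] := good (sc m z0); [exact: sc01..|].
  have Ws (x' : R * R) : `|x'.1 - z0.1| <= d -> `|x'.2 - z0.2| <= d ->
      W (sc m x') /\ W (sc m.+1 x').
    move=> x1 x2.
    (* The radius 2 / (N + 1) has two sources: x' is within d = 1 / (N + 1) of z0, and passing from
       m to m + 1 moves a point of the unit square by at most d more. *)
    have aux (u v : R) : `|u - v| <= d -> 0 <= v <= 1 ->
      `|m%:R / N.+1%:R * u - m%:R / N.+1%:R * v| <= 2 / N.+1%:R /\
      `|m.+1%:R / N.+1%:R * u - m%:R / N.+1%:R * v| <= 2 / N.+1%:R.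
      move=> uv /andP[v0 v1]; split.
        by apply: le_trans (scle _ _ _ _ m1 uv) _; rewrite -/d; lra.
      have -> : m.+1%:R / N.+1%:R * u - m%:R / N.+1%:R * v =
        (m.+1%:R / N.+1%:R * u - m.+1%:R / N.+1%:R * v) + d * v.
        by rewrite -natr1 /d; ring.
      apply: le_trans (ler_normD _ _) _; rewrite -/d.
      have := scle _ _ _ _ mN uv.
      have : `|d * v| <= d 
        by rewrite ger0_norm; [rewrite ler_piMr // ltW|rewrite mulr_ge0 // ltW].
      lra.
    have [a1 b1] := aux _ _ x1 z01; have [a2 b2] := aux _ _ x2 z02.
    by split; apply: WW.
  (* The ends of two successive rungs lie in one set W on which c is a cocycle, so this square of
     the ladder commutes. *)
  have [Wx Wx'] := Ws x Vx1 Vx2; have [Wy Wy'] := Ws y Vy1 Vy2.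
  rewrite [lad x _]/= -mulgA cW // -(cW _ (sc m y)) // mulgA.
  by rewrite IH.
exists V.
  apply/nbhs_ballP; exists d => //= x [/= x1 x2]; split.
    by rewrite distrC ltW.
  by rewrite distrC ltW.
move=> x y Vx Vy; rewrite -(main N.+1 x y) // mulKg /sc divff ?lt0r_neq0 //.
by rewrite !mul1r -!surjective_pairing.
Qed.

End ladder.

Lemma lift_exists (c : R * R -> R * R -> H) : local_cocycle c ->
  exists l, forall z : R * R, 0 <= z.1 <= 1 -> 0 <= z.2 <= 1 ->
    exists2 V, nbhs z V &
      forall x y, V x -> V y -> ((l x)^-1 * l y)%g = c x y.
Proof.
move=> cc.
pose K : set (R * R) := `[0, 1] `*` `[0, 1].
have : compact K by apply: compact_setX; exact: segment_compact.
move=> /compact_near_coveringP.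
pose P N (z : R * R) := exists2 W, is_cocycle_on c W &
  forall y, `|y.1 - z.1| <= 2 / N.+1%:R -> `|y.2 - z.2| <= 2 / N.+1%:R -> W y.
move=> /(_ nat \oo P _) [].
  move=> z _; have [W /nbhs_ballP[e /= e0 eW] cW] := cc z.
  have e20 : 0 < e / 2 by rewrite divr_gt0.
  have e40 : 0 < e / 4 by rewrite divr_gt0.
  (* The centre z' is within e / 2 of z, and 2 / (N + 1) < e / 2, so the set around z' stays in the
     ball of radius e around z. *)
  exists (ball z (e / 2), [set N | N.+1%:R^-1 < e / 4]) => /=.
    split; first exact: nbhsx_ballx.
    exact: (near_infty_natSinv_lt (PosNum e40)).
  move=> [z' N] /= [[z1 z2] Ne]; exists W => // y y1 y2; apply: eW.
  have aux (u v w : R) : ball u (e / 2) v -> `|w - v| <= 2 / N.+1%:R ->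
      ball u e w.
    rewrite /ball /= => uv wv.
    have -> : u - w = (u - v) - (w - v) by ring.
    apply: le_lt_trans (ler_normB _ _) _.
    move: Ne uv wv => /=; move: (N.+1%:R^-1) => k Ne uv wv.
    lra.
  by split; [exact: aux z1 y1|exact: aux z2 y2].
move=> N _ /(_ N) /= /(_ (leqnn N)) PN.
eexists => z z1 z2; apply: (@ladder_lift c N) => // y y1 y2.
by apply: PN; split; rewrite /= in_itv.
Qed.

(** Through [clamp] the cocycle extends to the whole plane, where points can be scaled towards the
    origin; the lift found there is restricted to the square. *)
Lemma lift_square_exists (c : I * I -> I * I -> H) :
  local_cocycle c -> exists l, is_lift c l.
Proof.
move=> cc.
pose f (z : R * R) : I * I := (clamp z.1, clamp z.2).
have cf : continuous f.
  by apply: pair_cont; (apply: comp_cont; first exact: clamp_continuous);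
    [exact: fst_cont|exact: snd_cont].
pose g (z : I * I) : R * R := (uval z.1, uval z.2).
have cg : continuous g.
  by apply: pair_cont; (apply: comp_cont; first exact: uval_continuous);
    [exact: fst_cont|exact: snd_cont].
have gK z : f (g z) = z by rewrite /f /g /= !uvalK -surjective_pairing.
have [l ll] := lift_exists (local_cocycle_comp cf cc).
exists (l \o g) => z.
have [||V Vz lV] := ll (g z); [exact: uvalP..|].
exists (g @^-1` V); first exact: cg.
by move=> x y Vx Vy; rewrite /= lV // !gK.
Qed.

End lifting.

(** * Fundamental groupoid *)

Lemma addr_cont (R : realType) (X : topologicalType) (u v : X -> R) :
  continuous u -> continuous v -> continuous (fun x => u x + v x).
Proof. by move=> cu cv x; apply: cvgD; [exact: cu|exact: cv]. Qed.

Lemma mulr_cont (R : realType) (X : topologicalType) (u v : X -> R) :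
  continuous u -> continuous v -> continuous (fun x => u x * v x).
Proof. by move=> cu cv x; apply: cvgM; [exact: cu|exact: cv]. Qed.

Lemma multiplicative_of_morph (G K : groupType) (f : G -> K) :
  {morph f : x y / (x * y)%g} -> exists phi : {multiplicative G -> K}, phi =1 f.
Proof.
move=> fM; pose m := isMultiplicative.Build G K f fM.
by exists (HB.pack_for {multiplicative G -> K} f m).
Qed.

Lemma multiplicative1 (G K : groupType) (f : {multiplicative G -> K}) :
  f 1%g = 1%g.
Proof.
have /(congr1 (fun g => (f 1)^-1 * g)%g) := gmulfM (s := f) 1%g 1%g.
by rewrite mulKg mulg1 mulVg.
Qed.

Lemma multiplicativeV (G K : groupType) (f : {multiplicative G -> K}) x :
  f (x^-1)%g = ((f x)^-1)%g.
Proof.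
have /(congr1 (fun g => (f x)^-1 * g)%g) := gmulfM (s := f) x (x^-1)%g.
by rewrite mulKg mulgV multiplicative1 mulg1.
Qed.

Lemma is_free_basis_iso (G K : groupType) (B : Type) (b : B -> G)
    (F : {multiplicative G -> K}) (F' : {multiplicative K -> G}) :
  cancel F F' -> cancel F' F -> is_free_basis b -> is_free_basis (F \o b).
Proof.
move=> FK F'K fb L f; have [[phi phib] uniq] := fb L f; split.
  exists (phi \o F') => i /=; by rewrite FK.
move=> phi1 phi2 h1 h2 y.
by have := uniq (phi1 \o F) (phi2 \o F) h1 h2 (F' y); rewrite /= F'K.
Qed.

Section transports.
Context {R : realType} {X : topologicalType}.
Local Notation I := (unitI R).

Lemma eq_path_homotopic {x y : X} (a b : {path I from x to y}) :
  a =1 b -> path_homotopic a b.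
Proof. by move=> /path_eqP ->; exact: path_homotopic_refl. Qed.

(* A groupoid morphism from the fundamental groupoid of [X] to [H]. *)
Definition is_transport (H : groupType)
    (Phi : forall x y : X, {path I from x to y} -> H) :=
  (forall x y (a b : {path I from x to y}),
     path_homotopic a b -> Phi x y a = Phi x y b) /\
  (forall x y z (a : {path I from x to y}) (b : {path I from y to z}),
     Phi x z (path_concat a b) = (Phi x y a * Phi y z b)%g).

Section transport_theory.
Context {H : groupType} {Phi : forall x y : X, {path I from x to y} -> H}.
Hypothesis tPhi : is_transport Phi.

Lemma transport_const x : Phi (path_const x) = 1%g.
Proof.
have [ho co] := tPhi.
have := ho _ _ _ _ (path_concat1l (path_const x)); rewrite co => e.
by have /(congr1 (fun g => (Phi (path_const x))^-1 * g)%g) := e;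
  rewrite mulKg mulVg.
Qed.

Lemma transport_reverse x y (a : {path I from x to y}) :
  Phi (path_reverse a) = ((Phi a)^-1)%g.
Proof.
have [ho co] := tPhi.
have := ho _ _ _ _ (path_concatV a); rewrite co transport_const => e.
by have /(congr1 (fun g => (Phi a)^-1 * g)%g) := e; rewrite mulKg mulg1.
Qed.

(** Endpoints such as [a zero] and [x] are equal without being convertible, so two paths with the
    same points may have different types. *)
Lemma transport_cast x y x' y' (a : {path I from x to y})
  (b : {path I from x' to y'}) : x = x' -> y = y' -> a =1 b -> Phi a = Phi b.
Proof.
move=> ex ey; subst x' y'; move=> ab.
by apply: tPhi.1; exact: eq_path_homotopic.
Qed.

Lemma transport_hom (x : X) (h : H) : exists phi : {multiplicative pi1 R x -> H},
  forall a : {path I from x to x}, phi (loop_class a) = (h^-1 * Phi a * h)%g.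
Proof.
have [ho co] := tPhi.
have [|phi phiE] := @multiplicative_of_morph (pi1 R x) H
    (fun u => (h^-1 * Phi (repr u) * h)%g).
  move=> u v /=.
  rewrite -[(u * v)%g]/(pi1_mul u v) /pi1_mul (ho _ _ _ _ (repr_loop_class _)).
  by rewrite co !mulgA mulgK.
by exists phi => a; rewrite phiE (ho _ _ _ _ (repr_loop_class a)).
Qed.

End transport_theory.

(** Closing paths up along [r] lets two morphisms be compared on the pieces of a loop. Nothing is
    asked of [r x], so on loops at x the result is only a conjugate of [phi]. *)
Lemma hom_transport (H : groupType) (x : X) (r : forall y, {path I from x to y})
    (phi : {multiplicative pi1 R x -> H}) :
  is_transport (fun y z (a : {path I from y to z}) =>
    phi (loop_class (path_concat (r y) (path_concat a (path_reverse (r z)))))).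
Proof.
split=> [y z a b ab|y z w a b].
  congr (phi _); apply/loop_classP; apply: path_concat_homotopic.
    exact: path_homotopic_refl.
  by apply: path_concat_homotopic => //; exact: path_homotopic_refl.
rewrite -gmulfM -[(_ * _)%g]/(pi1_mul _ _) pi1_mulE; congr (phi _).
apply/loop_classP.
apply: path_homotopic_trans; last exact: path_concatA.
apply: path_concat_homotopic; first exact: path_homotopic_refl.
apply: path_homotopic_trans; last exact: path_concatA.
apply: path_homotopic_trans; first exact: path_homotopic_sym (path_concatA _ _ _).
apply: path_concat_homotopic; first exact: path_homotopic_refl.
apply: path_homotopic_sym.
apply: path_homotopic_trans; first exact: path_concatA.
apply: path_homotopic_trans.
  apply: path_concat_homotopic; first exact: path_concatVl.
  exact: path_homotopic_refl.
exact: path_concat1l.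
Qed.

(** This is the monodromy of the H-covering glued by J, without constructing the covering: a path is
    sent to the increment of a lift along it. The second clause allows it to be computed from any
    lift. *)
Lemma monodromy (H : groupType) (J : X -> X -> H) : local_cocycle J ->
  exists Phi : forall x y, {path I from x to y} -> H, is_transport Phi /\
    forall x y (a : {path I from x to y}) l,
      is_lift (fun s t => J (a s) (a t)) l -> Phi x y a = ((l zero)^-1 * l one)%g.
Proof.
move=> cJ.
have cfix (s : I) : continuous (fun t : I => (t, s)).
  by apply: pair_cont => [?|]; [exact: cvg_id|exact: cst_continuous].
have cfix' (s : I) : continuous (fun t : I => (s, t)).
  by apply: pair_cont => [|?]; [exact: cst_continuous|exact: cvg_id].
have ex x y (a : {path I from x to y}) :
    exists l, is_lift (fun s t => J (a s) (a t)) l.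
  (* A lift on the interval is the restriction to one side of a lift on the square, for a cocycle
     constant in the second variable. *)
  have [|l ll] := @lift_square_exists R H (fun z w => J (a z.1) (a w.1)).
    apply: (@local_cocycle_comp H (I * I)%type X (fun z => a z.1)) => //.
    by apply: (comp_cont (g := a)); [exact: cts_fun|exact: fst_cont].
  by exists (l \o (fun t => (t, zero))); exact: is_lift_comp (cfix zero) ll.
pose lift x y (a : {path I from x to y}) := projT1 (cid (ex x y a)).
have liftP x y (a : {path I from x to y}) :
  is_lift (fun s t => J (a s) (a t)) (lift x y a) := projT2 (cid (ex x y a)).
pose Phi x y (a : {path I from x to y}) :=
  ((lift x y a zero)^-1 * lift x y a one)%g.
have PhiE x y (a : {path I from x to y}) l :
    is_lift (fun s t => J (a s) (a t)) l -> Phi x y a = ((l zero)^-1 * l one)%g.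
  by move=> ll; apply: lift_unitI_unique ll.
exists Phi; split=> //; split=> [x y a b|x y z a b].
  move=> [K [cK Ka Kb Kx Ky]].
  have [l ll] := @lift_square_exists R H (fun z w => J (K z) (K w))
    (local_cocycle_comp cK cJ).
  have la : is_lift (fun s t => J (a s) (a t)) (fun t => l (t, zero)).
    have := is_lift_comp (cfix zero) ll.
    by under [X in is_lift X]eq_fun do under eq_fun do rewrite !Ka.
  have lb : is_lift (fun s t => J (b s) (b t)) (fun t => l (t, one)).
    have := is_lift_comp (cfix one) ll.
    by under [X in is_lift X]eq_fun do under eq_fun do rewrite !Kb.
  (* On the sides where the homotopy is stationary the cocycle is [J c c], that is 1, so the lift
     takes equal values at both corners and the two paths have the same increment. *)
  have side (s : I) c : (forall t, K (s, t) = c) -> l (s, zero) = l (s, one).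
    move=> Kc; have ls := is_lift_comp (cfix' s) ll.
    have lc : is_lift (fun _ _ : I => J c c) (l \o (fun t => (s, t))).
      by move: ls; under [X in is_lift X]eq_fun do under eq_fun do rewrite !Kc.
    have l1 : is_lift (fun _ _ : I => J c c) (fun=> 1%g : H).
      move=> t; exists setT; first exact: filterT.
      move=> _ _ _ _; have [W Wc cW] := cJ c.
      by rewrite (cocycle_refl cW) ?invg1 ?mulg1 //; exact: nbhs_singleton.
    have := lift_unitI_unique lc l1; rewrite invg1 mulg1 /= => e.
    by have /(congr1 (fun g => l (s, zero) * g)%g) := e; rewrite mulVKg mulg1.
  by rewrite (PhiE _ _ _ _ la) (PhiE _ _ _ _ lb) (side zero x) // (side one y).
set ab := path_concat a b; have ll := liftP _ _ ab.
(* Restricted to the two halves of the interval, a lift along the concatenation is a lift along each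
   factor. *)
pose h1 : I -> I := aff 2^-1 0; pose h2 : I -> I := aff 2^-1 2^-1.
have h1E t : uval (h1 t) = 2^-1 * uval t.
  by rewrite /h1 /aff clampK ?addr0 //; have /andP[] := uvalP t; lra.
have h2E t : uval (h2 t) = 2^-1 * uval t + 2^-1.
  by rewrite /h2 /aff clampK //; have /andP[] := uvalP t; lra.
have abh1 t : ab (h1 t) = a t.
  rewrite /ab /= /mk_path /concat_fun h1E; have /andP[t0 t1] := uvalP t.
  by rewrite ifT; [congr (a _); rewrite mulrA divff // mul1r uvalK|lra].
have abh2 t : ab (h2 t) = b t.
  rewrite /ab /= /mk_path /concat_fun h2E; have /andP[t0 t1] := uvalP t.
  have bE : clamp (2 * (2^-1 * uval t + 2^-1) - 1) = t.
    by rewrite -[RHS]uvalK; congr clamp; lra.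
  case: ifP => [t2|_]; last by rewrite bE.
  have t00 : uval t = 0 by lra.
  rewrite (_ : t = zero); last by apply: uval_inj; rewrite uval0.
  by rewrite path_zero uval0 mulr0 add0r mulfV // path_one.
have la : is_lift (fun s t => J (a s) (a t)) (lift _ _ ab \o h1).
  have := is_lift_comp (@aff_cont R 2^-1 0) ll.
  by under [X in is_lift X]eq_fun do under eq_fun do rewrite !abh1.
have lb : is_lift (fun s t => J (b s) (b t)) (lift _ _ ab \o h2).
  have := is_lift_comp (@aff_cont R 2^-1 2^-1) ll.
  by under [X in is_lift X]eq_fun do under eq_fun do rewrite !abh2.
rewrite (PhiE _ _ _ _ la) (PhiE _ _ _ _ lb) (PhiE _ _ _ _ ll) /=.
have -> : h1 zero = zero by apply: uval_inj; rewrite h1E uval0 mulr0.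
have -> : h1 one = h2 zero.
  by apply: uval_inj; rewrite h1E h2E uval0 uval1 mulr0 add0r mulr1.
have -> : h2 one = one by apply: uval_inj; rewrite h2E uval1; lra.
by rewrite [RHS]mulgA mulgK.
Qed.

Section subpaths.

Definition segI_fun (s t u : I) : I :=
  clamp ((1 - uval u) * uval s + uval u * uval t).

Lemma segI_cont s t : continuous (segI_fun s t).
Proof.
apply: comp_cont; first exact: clamp_continuous.
apply: addr_cont; apply: mulr_cont;
  [|exact: cst_continuous| |exact: cst_continuous].
  exact: (onem_cont (@uval_continuous R)).
exact: uval_continuous.
Qed.

Lemma segI0 s t : segI_fun s t zero = s.
Proof. by rewrite /segI_fun uval0 subr0 mul1r mul0r addr0 uvalK. Qed.

Lemma segI1 s t : segI_fun s t one = t.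
Proof. by rewrite /segI_fun uval1 subrr mul1r mul0r add0r uvalK. Qed.

Definition segI s t : {path I from s to t in I} :=
  mk_path (@segI_cont s t) (segI0 s t) (segI1 s t).

Context {x y : X} (a : {path I from x to y}).

Definition subpath s t : {path I from a s to a t} := a \o segI s t.

(** Both sides are [a] after paths of the interval with the same ends, and the interval is convex;
    s, t, u may come in any order. *)
Lemma subpath_concat s t u :
  path_homotopic (path_concat (subpath s t) (subpath t u)) (subpath s u).
Proof.
apply: (@reparam_homotopic _ _ _ _ a (path_concat (segI s t) (segI t u))
  (segI s u)).
- exact: cts_fun.
- exact: cts_fun.
- exact: cts_fun.
- by rewrite !path_zero.
- by rewrite !path_one.
- by move=> v; rewrite /= /mk_path /concat_fun /=; case: ifP.
- by [].
Qed.

End subpaths.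

(** The ratio of the two transports along the initial part of [a] is a locally constant function of
    its end, because moving the end adds a short subpath on which they agree. *)
Lemma transport_unique (H : groupType)
    (Phi Psi : forall x y : X, {path I from x to y} -> H) :
  is_transport Phi -> is_transport Psi ->
  (forall z : X, exists2 U, nbhs z U & forall x y (a : {path I from x to y}),
     (forall t, U (a t)) -> Phi x y a = Psi x y a) ->
  forall x y (a : {path I from x to y}), Phi x y a = Psi x y a.
Proof.
move=> tPhi tPsi loc x y a.
pose D (F : forall x y : X, {path I from x to y} -> H) t :=
  F _ _ (subpath a zero t).
have D0 F : is_transport F -> D F zero = 1%g.
  move=> tF; rewrite -(transport_const tF (a zero)).
  apply: transport_cast => // t /=; congr (a _).
  apply: uval_inj; rewrite /mk_path /segI_fun !uval0 !mulr0 addr0.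
  by rewrite clampK ?lexx ?ler01.
have D1 F : is_transport F -> D F one = F _ _ a.
  move=> tF; apply: transport_cast => //.
  - exact: path_zero.
  - exact: path_one.
  - move=> t /=; congr (a _).
    by rewrite /mk_path /segI_fun uval0 uval1 mulr0 add0r mulr1 uvalK.
have : (D Phi zero * (D Psi zero)^-1 = D Phi one * (D Psi one)^-1)%g.
  apply: (locally_constant_unitI (l := fun t => D Phi t * (D Psi t)^-1)%g) => t.
  have [U Ut aU] := loc (a t).
  have : nbhs (uval t) ((fun u => a (clamp u)) @^-1` U).
    have : continuous (fun u : R => a (clamp u)).
      by apply: comp_cont; [exact: cts_fun|exact: clamp_continuous].
    by apply; rewrite uvalK.
  move=> /nbhs_ballP[e /= e0 eU].
  exists (uval @^-1` ball (uval t) e).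
    by apply: uval_continuous; exact: nbhsx_ballx.
  move=> s s' /= bs bs'.
  have step F : is_transport F -> D F s' = (D F s * F _ _ (subpath a s s'))%g.
    by move=> tF; rewrite /D -tF.2; apply/esym/tF.1; exact: subpath_concat.
  rewrite !step // (aU _ _ (subpath a s s')) ?invMg ?mulgA ?mulgK //.
  move=> u; apply: eU; move: bs bs'; rewrite /ball /= => bs bs'.
  have /andP[u0 u1] := uvalP u.
  have -> : uval t - ((1 - uval u) * uval s + uval u * uval s') =
    (1 - uval u) * (uval t - uval s) + uval u * (uval t - uval s') by ring.
  apply: le_lt_trans (ler_normD _ _) _; rewrite !normrM.
  rewrite (ger0_norm u0) (@ger0_norm _ (1 - uval u)) ?subr_ge0 //.
  have [AB|BA] := leP `|uval t - uval s| `|uval t - uval s'|.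
    by apply: le_lt_trans bs'; nra.
  by apply: le_lt_trans bs; nra.
rewrite !D0 // !D1 // invg1 mulg1 => e.
by have /(congr1 (fun g => g * Psi _ _ a)%g) := e; rewrite mulgKV mul1g => <-.
Qed.

End transports.

(** * Transfer of both conclusions along a homeomorphism *)

Section homeomorphisms.
Context {R : realType} {X Y : topologicalType}.
Variables (f : X -> Y) (g : Y -> X).
Hypotheses (cf : continuous f) (cg : continuous g).
Hypotheses (fK : cancel f g) (gK : cancel g f).
Local Notation I := (unitI R).

Lemma homeo_is_free_of_rank (x : X) n :
  is_free_of_rank (pi1 R (f x)) n -> is_free_of_rank (pi1 R x) n.
Proof.
pose F (a : {path I from x to x}) : {path I from f x to f x} :=
  mk_path (comp_cont cf (@cts_fun _ _ a)) (congr1 f (path_zero (s := a)))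
    (congr1 f (path_one (s := a))).
have g0 (b : {path I from f x to f x}) : (fun t => g (b t)) zero = x.
  by rewrite path_zero fK.
have g1 (b : {path I from f x to f x}) : (fun t => g (b t)) one = x.
  by rewrite path_one fK.
pose G (b : {path I from f x to f x}) : {path I from x to x} :=
  mk_path (comp_cont cg (@cts_fun _ _ b)) (g0 b) (g1 b).
have hF a a' : path_homotopic a a' -> path_homotopic (F a) (F a').
  move=> [K [cK Ka Kb Kx Ky]]; exists (f \o K); split=> [|t|t|t|t] /=.
  - exact: comp_cont.
  - by rewrite Ka.
  - by rewrite Kb.
  - by rewrite Kx.
  - by rewrite Ky.
have hG a a' : path_homotopic a a' -> path_homotopic (G a) (G a').
  move=> [K [cK Ka Kb Kx Ky]]; exists (g \o K); split=> [|t|t|t|t] /=.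
  - exact: comp_cont.
  - by rewrite Ka.
  - by rewrite Kb.
  - by rewrite Kx fK.
  - by rewrite Ky fK.
have [|phi phiE] := @multiplicative_of_morph (pi1 R x) (pi1 R (f x))
    (fun u => loop_class (F (repr u))).
  move=> u v /=; rewrite -[RHS]/(pi1_mul _ _) pi1_mulE; apply/loop_classP.
  apply: path_homotopic_trans (hF _ _ (repr_loop_class _)) _.
  apply: eq_path_homotopic => t /=; rewrite /mk_path /concat_fun /=.
  by case: ifP.
have [|psi psiE] := @multiplicative_of_morph (pi1 R (f x)) (pi1 R x)
    (fun u => loop_class (G (repr u))).
  move=> u v /=; rewrite -[RHS]/(pi1_mul _ _) pi1_mulE; apply/loop_classP.
  apply: path_homotopic_trans (hG _ _ (repr_loop_class _)) _.
  apply: eq_path_homotopic => t /=; rewrite /mk_path /concat_fun /=.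
  by case: ifP.
move=> [b fb]; exists (psi \o b).
apply: (is_free_basis_iso (F := psi) (F' := phi)) => // u.
  rewrite psiE phiE -[RHS]loop_class_repr; apply/loop_classP.
  apply: path_homotopic_trans (hF _ _ (repr_loop_class _)) _.
  by apply: eq_path_homotopic => t /=; rewrite /mk_path gK.
rewrite psiE phiE -[RHS]loop_class_repr; apply/loop_classP.
apply: path_homotopic_trans (hG _ _ (repr_loop_class _)) _.
by apply: eq_path_homotopic => t /=; rewrite /mk_path fK.
Qed.

Lemma homeo_homotopy_equivalent (Z : topologicalType) :
  homotopy_equivalent R Y Z -> homotopy_equivalent R X Z.
Proof.
move=> [u [v [cu cv [K [cK K0 K1]] uv]]].
exists (u \o f), (g \o v); split; [exact: comp_cont|exact: comp_cont| |].
  exists (fun z => g (K (f z.1, z.2))); split => [|x|x] /=.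
  - apply: comp_cont => //; apply: comp_cont => //.
    apply: pair_cont; last exact: snd_cont.
    by apply: comp_cont => //; exact: fst_cont.
  - by rewrite K0.
  - by rewrite K1 /= fK.
rewrite (_ : (u \o f) \o (g \o v) = u \o v) //.
by apply/funext => z /=; rewrite gK.
Qed.

End homeomorphisms.

(** * The complex of rows and columns *)

Lemma ptws_cont (X V : topologicalType) (U : Type) (f : X -> {ptws U -> V}) :
  (forall u, continuous (fun x => f x u)) -> continuous f.
Proof.
move=> cf x; apply/cvg_sup => u W [V' [[B oB <-] Bfx] BW].
apply: (filterS BW).
have : nbhs (f x u) B by exact: open_nbhs_nbhs.
exact: (cf u x).
Qed.

Lemma set_type_cont (X Y : topologicalType) (A : set Y) (f : X -> set_type A) :
  continuous (fun x => set_val (f x)) -> continuous f.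
Proof.
by move=> cf; exact: (@continuous_comp_initial (set_type A) X Y set_val).
Qed.

Lemma set_val_cont (Y : topologicalType) (A : set Y) :
  continuous (set_val : set_type A -> Y).
Proof. exact: (@initial_continuous (set_type A) Y set_val). Qed.

Lemma sum_cont (R : realType) (X : topologicalType) (T : Type) (r : seq T)
    (P : pred T) (F : T -> X -> R) : (forall i, P i -> continuous (F i)) ->
  continuous (fun x => \sum_(i <- r | P i) F i x).
Proof.
move=> cF; elim: r => [|i r IH].
  by under eq_fun do rewrite big_nil; exact: cst_continuous.
have [Pi|/negbTE Pi] := boolP (P i).
  by under eq_fun do rewrite big_cons Pi; apply: addr_cont => //; exact: cF.
by under eq_fun do rewrite big_cons Pi.
Qed.

Section rook_complex.
Context {R : realType} {p q : nat}.
Local Notation I := (unitI R).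
Local Notation cell := ('I_p * 'I_q)%type.
Local Notation line := ('I_p + 'I_q)%type.

(* [inl i] is the [i]-th column and [inr j] the [j]-th row. *)
Definition on_line (L : line) (c : cell) : bool :=
  match L with inl i => c.1 == i | inr j => c.2 == j end.

Definition supp_on (w : cell -> R) (L : line) :=
  forall c, ~~ on_line L c -> w c = 0.

Definition rook_set : set {ptws cell -> R} :=
  [set w | [/\ forall c, 0 <= w c, \sum_c w c = 1 & exists L, supp_on w L]].

Definition rook : topologicalType := set_type rook_set.

Definition wt (w : rook) : cell -> R := set_val w.

Lemma wt_ge0 (w : rook) c : 0 <= wt w c.
Proof. by have [+ _ _] := set_valP w; exact. Qed.

Lemma wt_sum (w : rook) : \sum_c wt w c = 1.
Proof. by have [] := set_valP w. Qed.

Lemma wt_supp (w : rook) : exists L, supp_on (wt w) L.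
Proof. by have [] := set_valP w. Qed.

Lemma wt_inj (v w : rook) : wt v =1 wt w -> v = w.
Proof. by move=> vw; apply: val_inj; apply/funext => c; exact: vw. Qed.

Lemma wt_ex_gt0 (w : rook) : exists c, 0 < wt w c.
Proof.
apply: contrapT => /forallNP w0; have := wt_sum w; rewrite big1.
  by move/eqP; rewrite eq_sym oner_eq0.
move=> c _; apply/eqP; rewrite eq_le wt_ge0 andbT leNgt; exact/negP.
Qed.

Lemma wt_le1 (w : rook) c : wt w c <= 1.
Proof.
rewrite -(wt_sum w) (bigD1 c) //= lerDl; apply: sumr_ge0 => ? _.
exact: wt_ge0.
Qed.

Lemma wt_cont c : continuous (fun w : rook => wt w c).
Proof.
apply: (comp_cont (g := fun f : {ptws cell -> R} => f c)).
  exact: (@proj_continuous _ (fun=> R) c).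
exact: set_val_cont.
Qed.

Lemma rook_cont (X : topologicalType) (f : X -> rook) :
  (forall c, continuous (fun x => wt (f x) c)) -> continuous f.
Proof. by move=> cf; apply: set_type_cont; exact: ptws_cont. Qed.

Definition mk_rook (w : cell -> R) (w_rook : rook_set w) : rook :=
  exist _ w (mem_set w_rook).

(** The condition for a straight-line homotopy. It is not transitive, since a vertex is adjacent to
    points of its row and of its column; this is why intermediate maps appear later. *)
Definition adj (a b : rook) :=
  exists2 L, supp_on (wt a) L & supp_on (wt b) L.

Lemma adj_refl a : adj a a.
Proof. by have [L aL] := wt_supp a; exists L. Qed.

Lemma adj_sym a b : adj a b -> adj b a.
Proof. by move=> [L ? ?]; exists L. Qed.

Definition mix_wt (a b : rook) (t : I) (c : cell) : R :=
  (1 - uval t) * wt a c + uval t * wt b c.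

Lemma mix_supp a b t L : supp_on (wt a) L -> supp_on (wt b) L ->
  supp_on (mix_wt a b t) L.
Proof. by move=> aL bL c cL; rewrite /mix_wt aL // bL // !mulr0 addr0. Qed.

Lemma mix_subproof a b t : adj a b -> rook_set (mix_wt a b t).
Proof.
move=> [L aL bL]; have /andP[t0 t1] := uvalP t; split.
- by move=> c; rewrite addr_ge0 // mulr_ge0 ?wt_ge0 // subr_ge0.
- by rewrite big_split /= -!mulr_sumr !wt_sum !mulr1 subrK.
- by exists L; exact: mix_supp.
Qed.

Definition mix a b (h : adj a b) (t : I) : rook := mk_rook (mix_subproof t h).

Lemma wt_mix a b (h : adj a b) t : wt (mix h t) = mix_wt a b t.
Proof. by []. Qed.

Lemma mix0 a b (h : adj a b) : mix h zero = a.
Proof.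
by apply: wt_inj => c; rewrite wt_mix /mix_wt uval0 subr0 mul1r mul0r addr0.
Qed.

Lemma mix1 a b (h : adj a b) : mix h one = b.
Proof.
by apply: wt_inj => c; rewrite wt_mix /mix_wt uval1 subrr mul1r mul0r add0r.
Qed.

Lemma mixx a (h : adj a a) t : mix h t = a.
Proof. by apply: wt_inj => c; rewrite wt_mix /mix_wt; ring. Qed.

Lemma mix_cont (X : topologicalType) (F G : X -> rook)
    (h : forall x, adj (F x) (G x)) : continuous F -> continuous G ->
  continuous (fun z : X * I => mix (h z.1) z.2).
Proof.
move=> cF cG; apply: rook_cont => c; rewrite /wt /= /mix_wt.
have c2 : continuous (fun z : X * I => uval z.2).
  by apply: comp_cont; [exact: uval_continuous|exact: snd_cont].
have cw K : continuous K -> continuous (fun z : X * I => wt (K z.1) c).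
  move=> cK; apply: (comp_cont (g := fun w => wt w c)); first exact: wt_cont.
  by apply: comp_cont => //; exact: fst_cont.
apply: addr_cont; apply: mulr_cont; [exact: onem_cont|exact: cw|by []|exact: cw].
Qed.

Lemma adj_homotopic (X : topologicalType) (F G : X -> rook) :
  continuous F -> continuous G -> (forall x, adj (F x) (G x)) ->
  homotopic R F G.
Proof.
move=> cF cG h; exists (fun z => mix (h z.1) z.2); split.
- exact: mix_cont.
- by move=> x; exact: mix0.
- by move=> x; exact: mix1.
Qed.

Lemma adj_path_homotopic x y (a b : {path I from x to y}) :
  (forall t, adj (a t) (b t)) -> path_homotopic a b.
Proof.
move=> h; exists (fun z => mix (h z.1) z.2); split.
- by apply: mix_cont; exact: cts_fun.
- by move=> t; exact: mix0.
- by move=> t; exact: mix1.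
- by move=> s /=; move: (h zero); rewrite !path_zero => ?; exact: mixx.
- by move=> s /=; move: (h one); rewrite !path_one => ?; exact: mixx.
Qed.

Lemma seg_cont a b (h : adj a b) : continuous (mix h).
Proof.
apply: (@comp_cont I (I * I)%type rook (fun z : I * I => mix h z.2)
  (fun t => (t, t))).
  by apply: mix_cont; exact: cst_continuous.
by apply: pair_cont => ?; exact: cvg_id.
Qed.

Definition seg a b (h : adj a b) : {path I from a to b} :=
  mk_path (@seg_cont a b h) (mix0 h) (mix1 h).

Definition path_on x y (a : {path I from x to y}) L :=
  forall t, supp_on (wt (a t)) L.

Lemma path_on_homotopic x y (a b : {path I from x to y}) L :
  path_on a L -> path_on b L -> path_homotopic a b.
Proof. by move=> aL bL; apply: adj_path_homotopic => t; exists L. Qed.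

Lemma path_on_seg a b (h : adj a b) L :
  supp_on (wt a) L -> supp_on (wt b) L -> path_on (seg h) L.
Proof. by move=> aL bL t; exact: mix_supp. Qed.

Lemma path_on_concat x y z (a : {path I from x to y}) (b : {path I from y to z})
  L : path_on a L -> path_on b L -> path_on (path_concat a b) L.
Proof. by move=> aL bL t; rewrite /= /mk_path /concat_fun; case: ifP. Qed.

(* The segments from [z] to the points of its star stay in the complex. *)
Definition star (z : rook) : set rook :=
  [set w | forall c, 0 < wt z c -> 0 < wt w c].

Lemma star_nbhs z : nbhs z (star z).
Proof.
have : forall c, \forall w \near z, 0 < wt z c -> 0 < wt w c.
  move=> c; have [zc|zc] := ltP 0 (wt z c); last exact: filterE.
  have : \forall w \near z, 0 < wt w c.
    by apply: (@wt_cont c z [set u | 0 < u]); exact: lt_nbhsr.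
  by apply: filterS.
by move=> /filter_forall.
Qed.

Lemma star_supp z w L : star z w -> supp_on (wt w) L -> supp_on (wt z) L.
Proof.
move=> zw wL c cL; apply/eqP; rewrite eq_le wt_ge0 andbT leNgt.
by apply/negP => /zw; rewrite (wL _ cL) ltxx.
Qed.

Lemma star_adj z w : star z w -> adj w z.
Proof.
by move=> zw; have [L wL] := wt_supp w; exists L => //; exact: star_supp wL.
Qed.

Lemma star_path_homotopic z x y (a : {path I from x to y})
    (hx : adj x z) (hy : adj z y) : (forall t, star z (a t)) ->
  path_homotopic a (path_concat (seg hx) (seg hy)).
Proof.
move=> az.
(* Padded with constant paths, both sides have the same three time intervals and are adjacent at
   each instant: x with the segment from x to z, then [a] with z, then y with the segment from z to
   y. *)
apply: path_homotopic_trans; first exact: path_homotopic_sym (path_concat1l _).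
apply: (@path_homotopic_trans _ _ _ _ _ (path_concat (path_const x)
  (path_concat a (path_const y)))).
  apply: path_concat_homotopic; first exact: path_homotopic_refl.
  exact: path_homotopic_sym (path_concat1r _).
apply: (@path_homotopic_trans _ _ _ _ _ (path_concat (seg hx)
  (path_concat (path_const z) (seg hy)))); last first.
  apply: path_concat_homotopic; first exact: path_homotopic_refl.
  exact: path_concat1l.
apply: adj_path_homotopic => t; rewrite /= /mk_path /concat_fun /= /mk_path.
case: ifP => _.
  by case: hx => L xL zL; exists L => //; exact: mix_supp.
rewrite /concat_fun; case: ifP => _; first exact: star_adj.
by case: hy => L xL zL; exists L => //; exact: mix_supp.
Qed.

Lemma supp_on_row (w : rook) j j' :
  supp_on (wt w) (inr j) -> supp_on (wt w) (inr j') -> j = j'.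
Proof.
move=> wj wj'; have [c c0] := wt_ex_gt0 w.
have cE k : supp_on (wt w) (inr k) -> c.2 = k.
  by move=> wk; apply/eqP; apply: contraLR c0 => /wk ->; rewrite ltxx.
by rewrite -(cE _ wj) (cE _ wj').
Qed.

Lemma supp_on_col (w : rook) i i' :
  supp_on (wt w) (inl i) -> supp_on (wt w) (inl i') -> i = i'.
Proof.
move=> wi wi'; have [c c0] := wt_ex_gt0 w.
have cE k : supp_on (wt w) (inl k) -> c.1 = k.
  by move=> wk; apply/eqP; apply: contraLR c0 => /wk ->; rewrite ltxx.
by rewrite -(cE _ wi) (cE _ wi').
Qed.

Lemma vtx_subproof (c : cell) : rook_set (fun d => (d == c)%:R).
Proof.
split=> [d||]; first exact: ler0n.
  rewrite (bigD1 c) //= eqxx big1 ?addr0 // => d /negbTE -> //.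
exists (inl c.1) => d /=; apply: contraNeq; rewrite pnatr_eq0 eqb0 negbK.
by move=> /eqP ->.
Qed.

Definition vtx (c : cell) : rook := mk_rook (vtx_subproof c).

Lemma wt_vtx c d : wt (vtx c) d = (d == c)%:R.
Proof. by []. Qed.

Lemma vtx_supp c L : on_line L c -> supp_on (wt (vtx c)) L.
Proof.
move=> cL d; rewrite wt_vtx; case: eqP => // -> /negP [] //.
Qed.

Lemma supp_on_vtx (w : rook) i j :
  supp_on (wt w) (inl i) -> supp_on (wt w) (inr j) -> w = vtx (i, j).
Proof.
move=> wi wj.
have w0 c : c != (i, j) -> wt w c = 0.
  rewrite -pair_eqE negb_and => /orP[/wi|/wj] //.
apply: wt_inj => c; rewrite wt_vtx; have [->|/w0 //] := eqVneq c (i, j).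
by have := wt_sum w; rewrite (bigD1 (i, j)) //= big1 ?addr0 // => d /w0.
Qed.

(* Vertices lie on a row and on a column; the row is preferred. *)
Definition ln (w : rook) : line :=
  match pselect (exists j, supp_on (wt w) (inr j)) with
  | left h => inr (projT1 (cid h))
  | right _ => projT1 (cid (wt_supp w))
  end.

Lemma ln_supp w : supp_on (wt w) (ln w).
Proof.
by rewrite /ln; case: pselect => [h|_]; [case: cid|case: cid].
Qed.

Lemma ln_row w j : supp_on (wt w) (inr j) -> ln w = inr j.
Proof.
move=> wj; rewrite /ln; case: pselect => [h|[]]; last by exists j.
by case: cid => j' /= wj'; rewrite (supp_on_row wj wj').
Qed.

End rook_complex.
Arguments rook : clear implicits.
Arguments ln_supp {R p q} w.

(** * Its fundamental group *)

Section rook_fundamental_group.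
Context {R : realType} {p q : nat}.
Local Notation I := (unitI R).
Local Notation rook := (rook R p.+1 q.+1).
Local Notation cell := ('I_p.+1 * 'I_q.+1)%type.
Local Notation line := ('I_p.+1 + 'I_q.+1)%type.

Section row_column_cocycle.
Context {H : groupType} (f : cell -> H).

Definition line_jump (L M : line) : H :=
  match L, M with
  | inr j, inl i => f (i, j)
  | inl i, inr j => ((f (i, j))^-1)%g
  | _, _ => 1%g
  end.

Definition rook_jump (v w : rook) : H := line_jump (ln v) (ln w).

Lemma star_row (z v w : rook) j j' : star z v -> star z w ->
  ln v = inr j -> ln w = inr j' -> j = j'.
Proof.
move=> zv zw vj wj'; apply: (@supp_on_row _ _ _ z).
  by apply: star_supp zv _; rewrite -vj; exact: ln_supp.
by apply: star_supp zw _; rewrite -wj'; exact: ln_supp.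
Qed.

Lemma star_col (z v w : rook) i i' : star z v -> star z w ->
  ln v = inl i -> ln w = inl i' -> i = i'.
Proof.
move=> zv zw vi wi'; apply: (@supp_on_col _ _ _ z).
  by apply: star_supp zv _; rewrite -vi; exact: ln_supp.
by apply: star_supp zw _; rewrite -wi'; exact: ln_supp.
Qed.

(** In the star of z, each line chosen by [ln] contains z, and z lies on at most one row and one
    column. So at most two lines occur among the three points. *)
Lemma rook_jump_cocycle : local_cocycle rook_jump.
Proof.
move=> z; exists (star z); first exact: star_nbhs.
move=> u v w zu zv zw; rewrite /rook_jump.
have row := @star_row z; have col := @star_col z.
case eu : (ln u) => [iu|ju]; case ev : (ln v) => [iv|jv];
  case ew : (ln w) => [iw|jw] //=; rewrite ?mulg1 ?mul1g //.
- by rewrite (col _ _ _ _ zu zv eu ev).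
- by rewrite (col _ _ _ _ zu zw eu ew) mulVg.
- by rewrite (row _ _ _ _ zv zw ev ew).
- by rewrite (col _ _ _ _ zv zw ev ew).
- by rewrite (row _ _ _ _ zu zw eu ew) mulgV.
- by rewrite (row _ _ _ _ zu zv eu ev).
Qed.

Variable Phi : forall x y : rook, {path I from x to y} -> H.
Hypothesis PhiE : forall x y (a : {path I from x to y}) l,
  is_lift (fun s t => rook_jump (a s) (a t)) l ->
  Phi a = ((l zero)^-1 * l one)%g.

Lemma monodromy_row x y (a : {path I from x to y}) j :
  path_on a (inr j) -> Phi a = 1%g.
Proof.
move=> aj; rewrite (PhiE (l := fun=> 1%g)) ?mulVg // => t.
exists setT; first exact: filterT.
by move=> s s' _ _; rewrite mulVg /rook_jump !(ln_row (aj _)).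
Qed.

(** Inside the column, [ln] is the column except at vertices, where the row is preferred. The lift
    [l] measures each chosen line against the column; the two factors come from the endpoints, which
    are vertices. *)
Lemma monodromy_col i j j' (a : {path I from vtx (i, j) to vtx (i, j')}) :
  path_on a (inl i) -> Phi a = (f (i, j) * (f (i, j'))^-1)%g.
Proof.
move=> ai.
pose l t : H := match ln (a t) with inr j => ((f (i, j))^-1)%g | inl _ => 1%g end.
rewrite (PhiE (l := l)).
  have lnv j0 : ln (vtx (i, j0) : rook) = inr j0.
    by apply: ln_row; apply: vtx_supp; exact: eqxx.
  by rewrite /l path_zero path_one !lnv invgK.
move=> t; exists (a @^-1` star (a t)).
  by apply: (@cts_fun _ _ a); exact: star_nbhs.
move=> s s' as_ as'; rewrite /l /rook_jump.
have col k u : star (a t) (a u) -> ln (a u) = inl k -> k = i.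
  move=> zu e; apply: (@supp_on_col _ _ _ (a u)); last exact: ai.
  by rewrite -e; exact: ln_supp.
case es : (ln (a s)) => [k|k]; case es' : (ln (a s')) => [k'|k'] /=.
- by rewrite invg1 mulg1.
- by rewrite (col k s) // invg1 mul1g.
- by rewrite (col k' s') // invgK mulg1.
- by rewrite (star_row as_ as' es es') mulVg.
Qed.

End row_column_cocycle.

(* Every line meets one of the two axes, row 0 and column 0, in its hub. *)
Definition hub (L : line) : cell :=
  match L with inl i => (i, ord0) | inr j => (ord0, j) end.

Definition axis (L : line) : line :=
  match L with inl _ => inr ord0 | inr _ => inl ord0 end.

Local Notation origin := (vtx (ord0, ord0) : rook).

Lemma hub_line L : on_line L (hub L). Proof. by case: L => k /=. Qed.

Lemma axis_hub L : on_line (axis L) (hub L). Proof. by case: L => k /=. Qed.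

Lemma axis_origin L : on_line (axis L) (ord0, ord0). Proof. by case: L. Qed.

Lemma adj_vtx (L : line) c d : on_line L c -> on_line L d ->
  adj (vtx c : rook) (vtx d).
Proof. by move=> cL dL; exists L; exact: vtx_supp. Qed.

Lemma adj_vtxl (L : line) c (w : rook) : on_line L c -> supp_on (wt w) L ->
  adj (vtx c) w.
Proof. by move=> cL wL; exists L => //; exact: vtx_supp. Qed.

Lemma adj_vtxr (L : line) c (w : rook) : on_line L c -> supp_on (wt w) L ->
  adj w (vtx c).
Proof. by move=> cL wL; exists L => //; exact: vtx_supp. Qed.

(** This plays the role of a maximal tree. The line is an argument because a vertex can be reached
    along its row or along its column, and the discrepancy is a box loop. *)
Definition from_origin L (w : rook) (wL : supp_on (wt w) L) :
    {path I from origin to w} :=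
  path_concat (seg (adj_vtx (axis_origin L) (axis_hub L)))
              (seg (adj_vtxl (hub_line L) wL)).

Definition to_origin (m : rook) : {path I from m to origin} :=
  path_concat (seg (adj_vtxr (hub_line (ln m)) (ln_supp m)))
              (seg (adj_vtx (axis_hub (ln m)) (axis_origin (ln m)))).

Definition via (m : rook) L (w : rook) (wL : supp_on (wt w) L) :
    {path I from m to w} :=
  path_concat (to_origin m) (from_origin wL).

Lemma via_seg (m : rook) L (v w : rook)
  (vL : supp_on (wt v) L) (wL : supp_on (wt w) L)
  (h : adj v w) : path_homotopic (path_concat (via m vL) (seg h)) (via m wL).
Proof.
apply: path_homotopic_trans; first exact: path_homotopic_sym (path_concatA _ _ _).
apply: path_concat_homotopic; first exact: path_homotopic_refl.
apply: path_homotopic_trans; first exact: path_homotopic_sym (path_concatA _ _ _).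
apply: path_concat_homotopic; first exact: path_homotopic_refl.
apply: (@path_on_homotopic _ _ _ _ _ _ _ L).
  by apply: path_on_concat; apply: path_on_seg => //; apply: vtx_supp;
    exact: hub_line.
by apply: path_on_seg => //; apply: vtx_supp; exact: hub_line.
Qed.

(* The loop through the hubs of column [i], and of row [j], and their
   common vertex. *)
Definition box_loop (m : rook) (c : cell) : {path I from m to m} :=
  path_concat
    (via m (vtx_supp (L := inl c.1) (c := c) (eqxx _)))
    (path_reverse (via m (vtx_supp (L := inr c.2) (c := c) (eqxx _)))).

(** Both routes from the origin to a cell of an axis stay on that axis, so only the inner cells give
    generators. *)
Lemma via_vtx_axis m c (hl : supp_on (wt (vtx c)) (inl c.1))
    (hr : supp_on (wt (vtx c)) (inr c.2)) : c.1 = ord0 \/ c.2 = ord0 ->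
  path_homotopic (via m hl) (via m hr).
Proof.
case: c hl hr => i j /= hl hr ij0.
apply: path_concat_homotopic; first exact: path_homotopic_refl.
have [L [L0 Li Lj Lij]] : exists L : line, [/\ on_line L (ord0, ord0),
    on_line L (i, ord0), on_line L (ord0, j) & on_line L (i, j)].
  by case: ij0 => ->; [exists (inl ord0)|exists (inr ord0)].
by apply: (@path_on_homotopic _ _ _ _ _ _ _ L);
  apply: path_on_concat; apply: path_on_seg; exact: vtx_supp.
Qed.

Definition inner_cell (k : 'I_p * 'I_q) : cell := (lift ord0 k.1, lift ord0 k.2).

Lemma box_loop_class m : is_free_basis
  (fun k => loop_class (box_loop m (inner_cell k)) : pi1 R m).
Proof.
move=> H f; split.
  (* The value 1 on the axes makes the tree part trivial. The inverse is chosen because the column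
     leg from [(i, ord0)] to [(i, j)] contributes [fx (i, ord0)] times the inverse of
     [fx (i, j)]. *)
  pose fx (c : cell) := match unlift ord0 c.1, unlift ord0 c.2 with
    | Some i, Some j => ((f (i, j))^-1)%g | _, _ => 1%g end.
  have [Phi [tPhi PhiE]] := monodromy (R := R) (rook_jump_cocycle fx).
  have fx0l j : fx (ord0, j) = 1%g by rewrite /fx /= unlift_none.
  have fx0r i : fx (i, ord0) = 1%g.
    by rewrite /fx /= unlift_none; case: unlift.
  have fxE k : fx (inner_cell k) = ((f k)^-1)%g.
    by rewrite /fx !liftK -surjective_pairing.
  (* Every box loop starts and ends with the passage between m and the origin; conjugating by its
     transport cancels it. *)
  have [phi phiE] := transport_hom tPhi m (Phi _ _ (to_origin m)).
  have Prow := monodromy_row PhiE; have Pcol := monodromy_col PhiE.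
  have on v w L (h : adj (vtx v : rook) (vtx w)) : on_line L v -> on_line L w ->
    path_on (seg h) L by move=> vL wL; apply: path_on_seg; exact: vtx_supp.
  have axis1 L : Phi _ _ (seg (adj_vtx (axis_origin L) (axis_hub L))) = 1%g.
    case: L => [i|j].
      by apply: (Prow _ _ _ ord0); apply: on; exact: eqxx.
    by rewrite Pcol ?fx0l ?mulgV //; apply: on; exact: eqxx.
  have viaE L w (wL : supp_on (wt w) L) : Phi _ _ (via m wL) =
      (Phi _ _ (to_origin m) * Phi _ _ (seg (adj_vtxl (hub_line L) wL)))%g.
    rewrite (tPhi.2 _ _ _ (to_origin m) (from_origin wL)); congr (_ * _)%g.
    by rewrite (tPhi.2 _ _ _ (seg _) (seg _)) axis1 mul1g.
  exists phi => k; rewrite phiE (tPhi.2 _ _ _ (via _ _) (path_reverse _)).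
  rewrite (transport_reverse tPhi) !viaE.
  rewrite [X in ((_ * X)^-1)%g](Prow _ _ _ (inner_cell k).2) ?mulg1; last first.
    by apply: on; exact: eqxx.
  rewrite Pcol; last by apply: on; exact: eqxx.
  rewrite fx0r mul1g fxE invgK.
  by rewrite !mulgA mulVg mul1g mulgKV.
move=> phi psi phib psib.
have h (k : 'I_p * 'I_q) : phi (loop_class (box_loop m (inner_cell k))) =
  psi (loop_class (box_loop m (inner_cell k))) by rewrite phib psib.
(* Once extended to all paths by [r], the two morphisms need comparing only inside a star, where a
   path reduces to two segments through the centre. *)
pose r w := via m (ln_supp w).
have tphi := hom_transport r phi; have tpsi := hom_transport r psi.
(* By [via_seg] the loop only compares the routes to z along [ln w] and along [ln z]. These lines
   differ only if z is a vertex and w is in its column; the loop is then trivial if z is on an axis,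
   and otherwise a box loop. *)
have local z w (zw : star z w) (hwz : adj w z) :
    phi (loop_class (path_concat (r w)
      (path_concat (seg hwz) (path_reverse (r z))))) =
    psi (loop_class (path_concat (r w)
      (path_concat (seg hwz) (path_reverse (r z))))).
  have zL := star_supp zw (ln_supp w).
  have -> : loop_class (path_concat (r w)
      (path_concat (seg hwz) (path_reverse (r z))))
    = loop_class (path_concat (via m zL) (path_reverse (r z))).
    apply/loop_classP.
    apply: path_homotopic_trans; first exact: path_concatA.
    apply: path_concat_homotopic; last exact: path_homotopic_refl.
    exact: via_seg.
  have triv : path_homotopic (via m zL) (r z) ->
      phi (loop_class (path_concat (via m zL) (path_reverse (r z)))) =
      psi (loop_class (path_concat (via m zL) (path_reverse (r z)))).
    move=> e; have -> : loop_class (path_concat (via m zL) (path_reverse (r z)))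
        = 1%g :> pi1 R m.
      apply/loop_classP; apply: path_homotopic_trans (path_concatV (r z)).
      by apply: path_concat_homotopic => //; exact: path_homotopic_refl.
    by rewrite !multiplicative1.
  move: zL triv; rewrite /r; case lw : (ln w) => [i|j] zL; last first.
    move: (ln_supp z); rewrite (ln_row zL) => zL' triv; apply: triv.
    by rewrite (Prop_irrelevance zL zL'); exact: path_homotopic_refl.
  move: (ln_supp z); case: (ln z) => [i'|j] zL' triv.
    have e := supp_on_col zL zL'; subst i'; apply: triv.
    by rewrite (Prop_irrelevance zL zL'); exact: path_homotopic_refl.
  have zE := supp_on_vtx zL zL'; subst z.
  have [ij0|ij0] := pselect (i = ord0 \/ j = ord0).
    by apply: triv; exact: (@via_vtx_axis m (i, j)).
  have [i' ei] : exists i', i = lift ord0 i'.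
    by case: (unliftP ord0 i) => [i' ->|i0]; [exists i'|case: ij0; left].
  have [j' ej] : exists j', j = lift ord0 j'.
    by case: (unliftP ord0 j) => [j' ->|j0]; [exists j'|case: ij0; right].
  subst i j; have := h (i', j'); rewrite /box_loop.
  rewrite (Prop_irrelevance (vtx_supp _) zL).
  by rewrite (Prop_irrelevance (vtx_supp _) zL').
have all_paths := transport_unique tphi tpsi.
have {all_paths} {}local : forall x y (a : {path I from x to y}),
    phi (loop_class (path_concat (r x) (path_concat a (path_reverse (r y)))))
  = psi (loop_class (path_concat (r x) (path_concat a (path_reverse (r y))))).
  apply: all_paths => z; exists (star z); first exact: star_nbhs.
  move=> x y a az.
  have sx : star z x by rewrite -(path_zero (s := a)).
  have sy : star z y by rewrite -(path_one (s := a)).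
  have hx := star_adj sx; have hy := star_adj sy.
  have e := star_path_homotopic hx (adj_sym hy) az.
  have e' : path_homotopic (seg (adj_sym hy)) (path_reverse (seg hy)).
    apply: adj_path_homotopic => t.
    have [L yL zL] := hy; exists L; exact: mix_supp.
  rewrite (tphi.1 _ _ _ _ e) (tpsi.1 _ _ _ _ e) tphi.2 tpsi.2.
  rewrite (tphi.1 _ _ _ _ e') (tpsi.1 _ _ _ _ e').
  by rewrite (transport_reverse tphi) (transport_reverse tpsi) !local.
(* The extensions give conjugates by the image of the loop [r m]. Since [r origin] is homotopic to
   [to_origin m], that image is the transport of the path [to_origin m], so both morphisms agree on
   it and the conjugation can be removed. *)
have conj (F : {multiplicative pi1 R m -> H}) (a : {path I from m to m}) :
    F (loop_class (path_concat (r m) (path_concat a (path_reverse (r m))))) =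
    (F (loop_class (r m)) * F (loop_class a) * (F (loop_class (r m)))^-1)%g.
  have cM (b c : {path I from m to m}) :
      loop_class (path_concat b c) = (loop_class b * loop_class c)%g :> pi1 R m.
    by rewrite -pi1_mulE.
  have cV : loop_class (path_reverse (r m)) = ((loop_class (r m))^-1)%g :> pi1 R m.
    by rewrite -pi1_invE.
  by rewrite !cM cV !gmulfM multiplicativeV mulgA.
have base (F : {multiplicative pi1 R m -> H}) : F (loop_class (r m)) =
    F (loop_class (path_concat (r m) (path_concat (to_origin m)
        (path_reverse (r origin))))).
  congr (F _); apply/loop_classP/path_homotopic_sym.
  apply: path_homotopic_trans; last exact: path_concat1r.
  apply: path_concat_homotopic; first exact: path_homotopic_refl.
  apply: path_homotopic_trans; last exact: (path_concatV (to_origin m)).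
  apply: path_concat_homotopic; first exact: path_homotopic_refl.
  apply: path_reverse_homotopic.
  apply: path_homotopic_trans; last exact: path_concat1r.
  apply: path_concat_homotopic; first exact: path_homotopic_refl.
  have -> : path_const origin = seg (adj_refl origin).
    by apply/path_eqP => t /=; rewrite /mk_path mixx.
  rewrite /from_origin; move: (ln_supp origin); rewrite (_ : ln origin = inr ord0).
    move=> hs; apply: (@path_on_homotopic _ _ _ _ _ _ _ (inr ord0)).
      by apply: path_on_concat; apply: path_on_seg; exact: vtx_supp.
    by apply: path_on_seg; exact: vtx_supp.
  by apply: ln_row; exact: vtx_supp.
have rm : phi (loop_class (r m)) = psi (loop_class (r m)).
  by rewrite base local -base.
move=> u; rewrite -(loop_class_repr u); have := local _ _ (repr u).
rewrite !conj rm => e.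
have := congr1 (fun g => (psi (loop_class (r m)))^-1 * g *
  psi (loop_class (r m)))%g e.
by rewrite !mulgA !mulVg !mul1g !mulgKV.
Qed.

Lemma rook_is_free_of_rank (m : rook) : is_free_of_rank (pi1 R m) (p * q).
Proof.
have [f [g [fK gK]]] : exists (f : 'I_(p * q) -> 'I_p * 'I_q) g,
    cancel f g /\ cancel g f.
  have : #|{: 'I_p * 'I_q}| = (p * q)%N by rewrite card_prod !card_ord.
  move=> <-; exists enum_val, enum_rank.
  by split; [exact: enum_valK|exact: enum_rankK].
exists (fun k => loop_class (box_loop m (inner_cell (f k)))).
move=> H F.
have [[phi phiE] uniq] := box_loop_class m (F \o g); split.
  by exists phi => k; rewrite phiE /= fK.
move=> phi1 phi2 h1 h2; apply: uniq => k /=; [rewrite -h1|rewrite -h2];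
  by rewrite gK.
Qed.

End rook_fundamental_group.

(** * Equivalence with the wedge of circles *)

Lemma homotopic_trans (R : realType) (X Y : topologicalType) (f g h : X -> Y) :
  homotopic R f g -> homotopic R g h -> homotopic R f h.
Proof.
move=> [F [cF F0 F1]] [G [cG G0 G1]].
exists (fun z => if uval z.2 <= 2^-1 then F (z.1, aff 2 0 z.2)
                 else G (z.1, aff 2 (-1) z.2)); split=> [|x|x].
- have c2 m c : continuous (fun z : X * unitI R => (z.1, aff m c z.2)).
    apply: pair_cont; first exact: fst_cont.
    by apply: comp_cont; [exact: aff_cont|exact: snd_cont].
  apply: paste_continuous; [|exact: comp_cont|exact: comp_cont|].
    by apply: comp_cont; [exact: uval_continuous|exact: snd_cont].
  move=> [x s] /= us; rewrite /aff us (half01 (R := R)).2 addr0 subrr.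
  by rewrite -[clamp 1]/one -[clamp 0]/zero F1 G0.
- rewrite /= uval0 ifT ?invr_ge0 ?ler0n // /aff uval0 mulr0 addr0.
  by rewrite -[clamp 0]/zero F0.
- rewrite /= uval1 ifF; last by apply/negbTE; rewrite -ltNge; lra.
  rewrite /aff uval1 (_ : 2 * 1 + -1 = 1); last by lra.
  by rewrite -[clamp 1]/one G1.
Qed.

Lemma near_continuous (X Y : topologicalType) (f g : X -> Y) (x : X) :
  continuous g -> (\forall z \near x, f z = g z) -> f @ x --> f x.
Proof.
move=> cg fg V; rewrite (nbhs_singleton fg) => /(cg x) gV.
have /filterS : nbhs x ([set z | f z = g z] `&` (g @^-1` V)) by exact: filterI.
by apply=> z [/= -> ].
Qed.

(** * The circle as two half circles *)

Section circle_arcs.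
Context {R : realType}.
Local Notation I := (unitI R).

Definition circle_x (z : circle R) : R := (set_val z).1.
Definition circle_y (z : circle R) : R := (set_val z).2.

Lemma circle_x_cont : continuous circle_x.
Proof. by apply: comp_cont; [exact: fst_cont|exact: set_val_cont]. Qed.

Lemma circle_y_cont : continuous circle_y.
Proof. by apply: comp_cont; [exact: snd_cont|exact: set_val_cont]. Qed.

Lemma circleP z : circle_x z ^+ 2 + circle_y z ^+ 2 = 1.
Proof. exact: (set_valP z). Qed.

(** Half circles are parametrized by the abscissa 1 - 2t, which is affine in t and so is inverted by
    the affine formula of [circle_param]. *)
Definition height (t : I) : R := Num.sqrt (1 - (1 - 2 * uval t) ^+ 2).

Lemma height_ge0 t : 0 <= height t. Proof. exact: sqrtr_ge0. Qed.

Lemma height_sqr t : height t ^+ 2 = 1 - (1 - 2 * uval t) ^+ 2.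
Proof. by rewrite sqr_sqrtr //; have /andP[] := uvalP t; nra. Qed.

Lemma height_eq0 t : height t = 0 -> t = zero \/ t = one.
Proof.
move=> h0; have := height_sqr t; rewrite h0 expr0n /= => h.
have : uval t * (uval t - 1) = 0 by nra.
move/eqP; rewrite mulf_eq0 subr_eq0 => /orP[] /eqP t0; [left|right];
  by apply: uval_inj; rewrite t0 ?uval0 ?uval1.
Qed.

(* The upper ([b = true]) or lower half circle, from (1, 0) to (-1, 0). *)
Definition arc_fun (b : bool) (t : I) : R * R :=
  (1 - 2 * uval t, if b then height t else - height t).

Lemma arc_subproof b t : arc_fun b t \in @circle_set R.
Proof.
rewrite inE /circle_set /arc_fun /=.
by case: b; rewrite ?sqrrN height_sqr; ring.
Qed.

Definition arc b t : circle R := exist _ (arc_fun b t) (arc_subproof b t).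

Lemma height_cont : continuous height.
Proof.
apply: comp_cont; first exact: sqrt_continuous.
have c : continuous (fun t : I => 1 - 2 * uval t).
  apply: onem_cont; apply: mulr_cont; first exact: cst_continuous.
  exact: uval_continuous.
by apply: onem_cont; apply: mulr_cont.
Qed.

Lemma arc_cont b : continuous (arc b).
Proof.
apply: set_type_cont; apply: pair_cont.
  apply: onem_cont; apply: mulr_cont; first exact: cst_continuous.
  exact: uval_continuous.
case: b => /=; first exact: height_cont.
rewrite (_ : (fun x => _) = fun x => -1 * height x + 0).
  by apply: affine_cont; exact: height_cont.
by apply/funext => x; rewrite addr0 mulN1r.
Qed.

Lemma height0 : height zero = 0.
Proof. by rewrite /height uval0 mulr0 subr0 expr1n subrr sqrtr0. Qed.

Lemma height1 : height one = 0.
Proof. by rewrite /height uval1 (_ : 1 - _ = 0) ?sqrtr0 //; ring. Qed.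

Lemma arc0 b : arc b zero = circle_base R.
Proof.
apply: val_inj; rewrite /= /arc_fun height0 oppr0 uval0 mulr0 subr0.
by case: b.
Qed.

Lemma arc1 b b' : arc b one = arc b' one.
Proof.
apply: val_inj; rewrite /= /arc_fun height1 oppr0.
by case: b b' => [] [].
Qed.

Lemma arc_end b b' t : t = zero \/ t = one -> arc b t = arc b' t.
Proof. by move=> [] ->; [rewrite !arc0|exact: arc1]. Qed.

Definition circle_param (z : circle R) : I := clamp ((1 - circle_x z) / 2).

Lemma circle_paramE z : uval (circle_param z) = (1 - circle_x z) / 2.
Proof. by rewrite clampK //; have := circleP z; nra. Qed.

Lemma circle_param_cont : continuous circle_param.
Proof.
apply: comp_cont; first exact: clamp_continuous.
apply: mulr_cont; last exact: cst_continuous.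
by apply: onem_cont; exact: circle_x_cont.
Qed.

(** The sign of the ordinate is tested as [- circle_y z <= 0] to fit [paste_continuous]: maps given
    on the two halves glue if they agree at the ends of the parameter. *)
Lemma circle_param_end z : - circle_y z = 0 ->
  circle_param z = zero \/ circle_param z = one.
Proof.
move/eqP; rewrite oppr_eq0 => /eqP y0; apply: height_eq0; rewrite /height.
have := circleP z; rewrite circle_paramE y0 => e.
by rewrite (_ : 1 - _ = 0) ?sqrtr0 //; nra.
Qed.

Lemma circle_arc z : arc (- circle_y z <= 0) (circle_param z) = z.
Proof.
apply: val_inj; rewrite /= /arc_fun circle_paramE.
have e : height (circle_param z) = `|circle_y z|.
  rewrite /height circle_paramE -sqrtr_sqr; congr Num.sqrt.
  by have := circleP z; nra.
have -> : 1 - 2 * ((1 - circle_x z) / 2) = circle_x z by lra.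
rewrite e oppr_le0; have [y0|y0] := leP 0 (circle_y z).
  by rewrite ger0_norm // /circle_x /circle_y -surjective_pairing.
by rewrite ltr0_norm // opprK /circle_x /circle_y -surjective_pairing.
Qed.

Lemma arc_paste_cont (X : topologicalType) (u : X -> R) (t : X -> I) :
  continuous u -> continuous t ->
  (forall x, u x = 0 -> t x = zero \/ t x = one) ->
  continuous (fun x => arc (u x <= 0) (t x)).
Proof.
move=> cu ct ut.
rewrite (_ : (fun x => _) =
  fun x => if u x <= 0 then arc true (t x) else arc false (t x)).
  apply: paste_continuous => //; [| |by move=> x /ut; exact: arc_end];
    by apply: comp_cont => //; exact: arc_cont.
by apply/funext => x; case: ifP.
Qed.

Lemma circle_param_arc b t : circle_param (arc b t) = t.
Proof.
apply: uval_inj; rewrite circle_paramE /circle_x /=; lra.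
Qed.

Lemma circle_y_arc b t : (- circle_y (arc b t) <= 0) = b \/ t = zero \/ t = one.
Proof.
rewrite /circle_y /=; have := height_ge0 t; case: b.
  by rewrite oppr_le0; left.
rewrite opprK le_eqVlt => /predU1P[/esym /height_eq0|h0]; first by right.
by left; apply/negbTE; rewrite -ltNge.
Qed.

Lemma closed_circle_base : closed [set circle_base R].
Proof.
rewrite (_ : [set _] = circle_x @^-1` [set 1]).
  by apply: closed_comp => [? _|]; [exact: circle_x_cont|exact: closed_eq].
apply/seteqP; split=> z /= [].
  by move=> ->.
rewrite -[z]circle_arc; move=> x1; have -> : circle_param z = zero.
  apply: uval_inj; rewrite circle_paramE uval0 -(circle_arc z) x1; lra.
by rewrite arc0.
Qed.

End circle_arcs.

(** * Maps between the complex and a single circle, and the comparison map [retract] *)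

Section rook_wedge.
Context {R : realType} {p q : nat}.
Local Notation I := (unitI R).
Local Notation rook := (rook R p.+1 q.+1).
Local Notation cell := ('I_p.+1 * 'I_q.+1)%type.
Local Notation line := ('I_p.+1 + 'I_q.+1)%type.

Lemma supp_on_sum (w : rook) (P : pred cell) L : supp_on (wt w) L ->
  (forall c, on_line L c -> P c) -> \sum_(c | P c) wt w c = 1.
Proof.
move=> wL LP; rewrite -(wt_sum w) [RHS](bigID P) /= [X in _ + X]big1 ?addr0 //.
by move=> c Pc; apply: wL; apply: contra Pc; exact: LP.
Qed.

Lemma wt_eq1 (w : rook) c : wt w c = 1 -> w = vtx c.
Proof.
move=> w1; apply: wt_inj => d; rewrite wt_vtx.
have [->//|dc] := eqVneq d c.
have := wt_sum w; rewrite (bigD1 c) //= w1 => /eqP.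
rewrite -subr_eq0 addrC addrK psumr_eq0; last by move=> *; exact: wt_ge0.
by move=> /allP /(_ d); rewrite mem_index_enum dc => /(_ isT) /eqP.
Qed.

Lemma wt_pair_le1 (w : rook) c d : c != d -> wt w c + wt w d <= 1.
Proof.
move=> cd; rewrite -(wt_sum w) (bigD1 c) //= lerD2l (bigD1 d) 1?eq_sym //=.
by rewrite lerDl; apply: sumr_ge0 => *; exact: wt_ge0.
Qed.

Definition off_row (c : cell) (w : rook) : R :=
  \sum_(d | (d != c) && (d.2 == c.2)) wt w d.
Definition off_col (c : cell) (w : rook) : R :=
  \sum_(d | (d != c) && (d.1 == c.1)) wt w d.
(** If w has positive weight at c, one of the two sums vanishes, so the sign tells whether w is on
    the row or on the column of c. *)
Definition side (c : cell) (w : rook) : R := off_col c w - off_row c w.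

Lemma side_cont c : continuous (side c).
Proof.
rewrite /side (_ : (fun w => _) = fun w => off_col c w + (-1 * off_row c w + 0)).
  apply: addr_cont; last apply: affine_cont;
    by apply: sum_cont => d _; exact: wt_cont.
by apply/funext => w; rewrite addr0 mulN1r.
Qed.

Lemma off_row_ge0 c w : 0 <= off_row c w.
Proof. by apply: sumr_ge0 => *; exact: wt_ge0. Qed.

Lemma off_col_ge0 c w : 0 <= off_col c w.
Proof. by apply: sumr_ge0 => *; exact: wt_ge0. Qed.

Lemma off_col_row (c : cell) w : supp_on (wt w) (inr c.2) -> off_col c w = 0.
Proof.
move=> wL; apply: big1 => d /andP[dc d1]; apply: wL => /=.
by apply: contra dc => d2; rewrite -pair_eqE /= d1.
Qed.

Lemma off_row_col (c : cell) w : supp_on (wt w) (inl c.1) -> off_row c w = 0.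
Proof.
move=> wL; apply: big1 => d /andP[dc d2]; apply: wL => /=.
by apply: contra dc => d1; rewrite -pair_eqE /= d1.
Qed.

Lemma off_row_row (c : cell) w : supp_on (wt w) (inr c.2) ->
  off_row c w = 1 - wt w c.
Proof.
move=> wL; have := supp_on_sum (P := fun d => d.2 == c.2) wL (fun d h => h).
rewrite (bigD1 c) //= => <-; rewrite addrC addrK /off_row.
by apply: eq_bigl => d; rewrite andbC.
Qed.

Lemma off_col_col (c : cell) w : supp_on (wt w) (inl c.1) ->
  off_col c w = 1 - wt w c.
Proof.
move=> wL; have := supp_on_sum (P := fun d => d.1 == c.1) wL (fun d h => h).
rewrite (bigD1 c) //= => <-; rewrite addrC addrK /off_col.
by apply: eq_bigl => d; rewrite andbC.
Qed.

Lemma wt_gt0_line (w : rook) c L : 0 < wt w c -> supp_on (wt w) L ->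
  L = inl c.1 \/ L = inr c.2.
Proof.
move=> c0 wL; have cL : on_line L c.
  by apply: contraLR c0 => /wL ->; rewrite ltxx.
by case: L cL {wL} => k /= /eqP ->; [left|right].
Qed.

Definition side_line (c : cell) (w : rook) : line :=
  if side c w <= 0 then inr c.2 else inl c.1.

Lemma side_lineP c w : 0 < wt w c -> supp_on (wt w) (side_line c w).
Proof.
move=> c0; have [L wL] := wt_supp w; rewrite /side_line /side.
have [e|e] := wt_gt0_line c0 wL; rewrite e in wL; last first.
  by rewrite off_col_row // sub0r oppr_le0 off_row_ge0.
rewrite off_row_col // subr0; case: ifP => // h.
have w1 : wt w c = 1.
  have := off_col_ge0 c w; rewrite off_col_col //.
  by move: h (wt_le1 w c); rewrite off_col_col // => ? ? ?; lra.
by rewrite (wt_eq1 w1); apply: vtx_supp => /=.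
Qed.

(** It is [zero] up to weight 2 / 3 and [one] at the vertex. The threshold exceeds 1 / 2, so at most
    one cell passes it, and the gap between 1 / 2 and 2 / 3 leaves room for continuity of
    [to_wedge]. *)
Definition excess (c : cell) (w : rook) : I := clamp (3 * wt w c - 2).

Lemma excess_cont c : continuous (excess c).
Proof.
apply: comp_cont; first exact: clamp_continuous.
by apply: affine_cont; exact: wt_cont.
Qed.

Lemma excess0 c w : wt w c <= 2 / 3 -> excess c w = zero.
Proof. by move=> h; rewrite /excess clamp_le0 //; lra. Qed.

(** The sign can change only where c has weight 0 or at the vertex c itself; the two half circles
    agree there. *)
Lemma side_eq0 c w : side c w = 0 -> excess c w = zero \/ excess c w = one.
Proof.
move=> s0; have [c0|c0] := leP (wt w c) 0; first by left; apply: excess0; lra.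
right; rewrite /excess clamp_ge1 //; have [L wL] := wt_supp w.
move: s0; rewrite /side.
have [e|e] := wt_gt0_line c0 wL; rewrite e in wL.
  by rewrite off_row_col // off_col_col //; lra.
by rewrite off_col_row // off_row_row //; lra.
Qed.

Definition to_circle (c : cell) (w : rook) : circle R :=
  arc (side c w <= 0) (excess c w).

Lemma to_circle_cont c : continuous (to_circle c).
Proof.
apply: arc_paste_cont; [exact: side_cont|exact: excess_cont|exact: side_eq0].
Qed.

Definition corner (b : bool) (c : cell) : {path I from vtx (ord0, ord0) to vtx c} :=
  if b then from_origin (vtx_supp (L := inr c.2) (c := c) (eqxx _))
  else from_origin (vtx_supp (L := inl c.1) (c := c) (eqxx _)).

Lemma corner_end b b' c t : t = zero \/ t = one -> corner b c t = corner b' c t.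
Proof. by case=> ->; rewrite ?path_zero ?path_one. Qed.

Definition of_circle (c : cell) (z : circle R) : rook :=
  corner (- circle_y z <= 0) c (circle_param z).

Lemma of_circle_cont c : continuous (of_circle c).
Proof.
rewrite /of_circle (_ : (fun z => _) = fun z => if - circle_y z <= 0
  then corner true c (circle_param z) else corner false c (circle_param z)).
  have cc b : continuous (fun z => corner b c (circle_param z)).
    by apply: comp_cont; [exact: cts_fun|exact: circle_param_cont].
  apply: paste_continuous => //; last first.
    by move=> z /circle_param_end; exact: corner_end.
  rewrite (_ : (fun z => _) = fun z => -1 * circle_y z + 0).
    by apply: affine_cont; exact: circle_y_cont.
  by apply/funext => z; rewrite addr0 mulN1r.
by apply/funext => z; case: ifP.
Qed.

Lemma of_circle_arc c b t : of_circle c (arc b t) = corner b c t.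
Proof.
rewrite /of_circle circle_param_arc.
by case: (circle_y_arc b t) => [->//|]; exact: corner_end.
Qed.

Lemma of_circle_base c : of_circle c (circle_base R) = vtx (ord0, ord0).
Proof. by rewrite -(arc0 true) of_circle_arc path_zero. Qed.

Definition corner_line (b : bool) (c : cell) : line :=
  if b then inr c.2 else inl c.1.

Lemma corner_line_on b c : on_line (corner_line b c) c.
Proof. by case: b; rewrite /=. Qed.

Lemma wt_corner b (c d : cell) t : wt (corner b c t) d =
  if uval t <= 2^-1 then
    (1 - 2 * uval t) * (d == (ord0, ord0))%:R +
    2 * uval t * (d == hub (corner_line b c))%:R
  else (2 - 2 * uval t) * (d == hub (corner_line b c))%:R +
       (2 * uval t - 1) * (d == c)%:R.
Proof.
have /andP[t0 t1] := uvalP t.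
rewrite /corner; case: b; rewrite /= /mk_path /concat_fun /= /mk_path;
  case: (leP (uval t) 2^-1) => t2; rewrite wt_mix /mix_wt !wt_vtx clampK //; lra.
Qed.

Lemma corner_supp_axis b c t : uval t <= 2^-1 ->
  supp_on (wt (corner b c t)) (axis (corner_line b c)).
Proof.
move=> t2 d dL; rewrite wt_corner t2.
case: eqP dL => [->|_ dL]; first by rewrite axis_origin.
case: eqP dL => [->|_ dL]; first by rewrite axis_hub.
by rewrite !mulr0 addr0.
Qed.

Lemma corner_supp b c t : 2^-1 <= uval t ->
  supp_on (wt (corner b c t)) (corner_line b c).
Proof.
move=> t2 d dL; have dh : (d == hub (corner_line b c)) = false.
  by apply/negbTE; apply: contraNneq dL => ->; exact: hub_line.
have dc : (d == c) = false.
  by apply/negbTE; apply: contraNneq dL => ->; exact: corner_line_on.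
rewrite wt_corner dh dc !mulr0 !addr0; case: ifP => // t2'.
by rewrite (_ : 1 - _ = 0) ?mul0r ?addr0 //; lra.
Qed.

Definition is_axis (L : line) : bool :=
  match L with inl i => i == ord0 | inr j => j == ord0 end.

(** At weight 5 / 6 the value of [excess] is 1 / 2, the time at which [corner] passes the hub. Up to
    then the round trip is on the axis, and [sharp] vanishes. *)
Definition sharp (u : R) : R := Num.max 0 (6 * u - 5).

(* A map preserving every line, whose values share a line with those of the
   round trip through the wedge: it pushes the points of a line that are far
   from the inner vertices to the hub. *)
Definition retract_wt (L : line) (w : rook) (c : cell) : R :=
  if is_axis L then wt w c else
  if c == hub L then 1 - \sum_(d | d != hub L) sharp (wt w d)
  else sharp (wt w c).

Lemma sharp_ge0 u : 0 <= sharp u.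
Proof. by rewrite /sharp le_max lexx. Qed.

Lemma sharp_wt_le (w : rook) c : sharp (wt w c) <= wt w c.
Proof.
by rewrite /sharp ge_max wt_ge0 /=; have := wt_le1 w c; lra.
Qed.

Lemma sharp_eq0 u : u <= 5 / 6 -> sharp u = 0.
Proof. by move=> h; rewrite /sharp max_l //; lra. Qed.

Lemma retract_supp L (w : rook) : supp_on (wt w) L -> supp_on (retract_wt L w) L.
Proof.
move=> wL c cL; rewrite /retract_wt; case: ifP => _; first exact: wL.
case: eqP => [e|_]; first by move: cL; rewrite e hub_line.
by rewrite (wL _ cL) sharp_eq0 //; lra.
Qed.

Lemma retract_subproof L (w : rook) : supp_on (wt w) L -> rook_set (retract_wt L w).
Proof.
move=> wL; split; last by exists L; exact: retract_supp.
  move=> c; rewrite /retract_wt; case: ifP => _; first exact: wt_ge0.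
  case: ifP => _; last exact: sharp_ge0.
  rewrite subr_ge0 -(wt_sum w) [leRHS](bigD1 (hub L)) //=.
  rewrite -[leLHS]add0r lerD ?wt_ge0 //; apply: ler_sum => d _.
  exact: sharp_wt_le.
rewrite /retract_wt; case: (is_axis L); first exact: wt_sum.
rewrite (bigD1 (hub L)) //= eqxx.
rewrite [X in _ + X](eq_bigr (fun d => sharp (wt w d))) ?subrK //.
by move=> d /negbTE ->.
Qed.

Definition retract (w : rook) : rook := mk_rook (retract_subproof (ln_supp w)).

(** A row and a column meet only at a vertex, so fixing the vertices makes [retract_wt] independent
    of the line chosen through a point. *)
Lemma retract_vtx L c : on_line L c -> retract_wt L (vtx c) =1 wt (vtx c).
Proof.
move=> cL d; rewrite /retract_wt; case: ifP => // _.
have s0 : sharp 0 = 0 by rewrite sharp_eq0 //; lra.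
have s1 : sharp 1 = 1 by rewrite /sharp max_r //; lra.
have sE e : sharp (wt (vtx c : rook) e) = (e == c)%:R.
  by rewrite wt_vtx; case: eqP.
case: eqP => [->|_]; last exact: sE.
rewrite (eq_bigr (fun e => (e == c)%:R)) ?wt_vtx => [|e _]; last exact: sE.
have [hc|hc] := eqVneq (hub L) c.
  rewrite big1 ?subr0 // => e; rewrite hc => /negbTE -> //.
rewrite (bigD1 c) 1?eq_sym //= eqxx big1 ?addr0 ?subrr // => e.
by move=> /andP[_ /negbTE ->].
Qed.

Lemma wt_retract L (w : rook) : supp_on (wt w) L ->
  wt (retract w) =1 retract_wt L w.
Proof.
move=> wL c; rewrite {1}/wt /= -[LHS]/(retract_wt (ln w) w c).
move: wL (ln_supp w); case: L => [i|j] wL; last by rewrite (ln_row wL).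
case: (ln w) => [i'|j] wL'; first by rewrite (supp_on_col wL wL').
rewrite (supp_on_vtx wL wL').
by rewrite retract_vtx /= ?retract_vtx /= ?eqxx.
Qed.

(** The lines form a finite closed cover: near [w0] only lines through [w0] occur, and for each of
    them [h L] takes the value [f w0] at [w0]. *)
Lemma closed_cover_cont (Y : topologicalType) (f : rook -> Y)
    (h : line -> rook -> Y) : (forall L, continuous (h L)) ->
  (forall L w, supp_on (wt w) L -> f w = h L w) -> continuous f.
Proof.
move=> ch fh w0 V Vf.
have : forall L, \forall w \near w0, supp_on (wt w) L -> V (f w).
  move=> L; have [w0L|w0L] := pselect (supp_on (wt w0) L); last first.
    apply: filterS (star_nbhs w0) => w sw wL; exfalso.
    by apply: w0L; exact: star_supp sw wL.
  have : nbhs (h L w0) V by rewrite -fh.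
  move=> /(ch L w0) hV; have {}hV : nbhs w0 (h L @^-1` V) by [].
  by apply: filterS hV => w /= Vw wL; rewrite (fh L).
move=> /filter_forall; apply: filterS => w Vw.
by have [L wL] := wt_supp w; exact: Vw wL.
Qed.

Lemma retract_cont : continuous retract.
Proof.
apply: rook_cont => c.
apply: (closed_cover_cont (h := fun L w => retract_wt L w c)); last first.
  by move=> L w wL; exact: wt_retract.
have sc d : continuous (fun w : rook => sharp (wt w d)).
  apply: max_cont; first exact: cst_continuous.
  by apply: affine_cont; exact: wt_cont.
move=> L; rewrite /retract_wt.
case: (is_axis L); first exact: wt_cont.
case: (c == hub L); last exact: sc.
by apply: onem_cont; apply: sum_cont => d _; exact: sc.
Qed.

Lemma retract_adj (w : rook) : adj (retract w) w.
Proof.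
exists (ln w); last exact: ln_supp.
by apply: retract_supp; exact: ln_supp.
Qed.

Lemma retract_hub L (w : rook) : ~~ is_axis L -> supp_on (wt w) L ->
  (forall d, d != hub L -> wt w d <= 5 / 6) -> supp_on (wt (retract w)) (axis L).
Proof.
move=> nL wL small c cL; rewrite (wt_retract wL) /retract_wt (negbTE nL).
rewrite ifF; last by apply/negbTE; apply: contraNneq cL => ->; exact: axis_hub.
rewrite sharp_eq0 // small //.
by apply: contraNneq cL => ->; exact: axis_hub.
Qed.

End rook_wedge.

Section wedge_equivalence.
Context {R : realType} {p q r : nat}.
Local Notation I := (unitI R).
Local Notation rook := (rook R p.+1 q.+1).
Local Notation cell := ('I_p.+1 * 'I_q.+1)%type.
Variables (k0 : 'I_r) (kc : 'I_r -> cell).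
Hypothesis kc_inj : injective kc.
Hypothesis kc_inner : forall k, (kc k).1 != ord0 /\ (kc k).2 != ord0.
Hypothesis kc_surj : forall c : cell, c.1 != ord0 -> c.2 != ord0 ->
  exists k, kc k = c.

Local Notation W := (wedge_of_circles R r).
Local Notation lift k :=
  (@wedge_lift 'I_r (fun=> circle R) (fun=> circle_base R) k).

Lemma lift_cont k : continuous (lift k : circle R -> W).
Proof. exact: (@wedge_lift_continuous 'I_r (fun=> circle R) _ k). Qed.

Definition to_wedge (w : rook) : W :=
  if [pick k | 2 / 3 < wt w (kc k)] is Some k
  then lift k (to_circle (kc k) w) else lift k0 (circle_base R).

Definition of_wedge : W -> rook := wedge_fun (fun k => of_circle (kc k)).

Lemma of_wedge_lift k z : of_wedge (lift k z) = of_circle (kc k) z.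
Proof. by rewrite /of_wedge wedge_lift_funE // => ? ?; rewrite !of_circle_base. Qed.

Lemma of_wedge_cont : continuous of_wedge.
Proof.
apply: wedge_fun_continuous => [k|? ?]; first exact: of_circle_cont.
by rewrite !of_circle_base.
Qed.

Lemma lift_base k k' : lift k (circle_base R) = lift k' (circle_base R).
Proof.
exact: (@wedge_liftE _ _ (fun=> circle_base R) k' (circle_base R) k
  (circle_base R)).
Qed.

Lemma to_wedge_lift k w : (forall k', k' != k -> wt w (kc k') <= 2 / 3) ->
  to_wedge w = lift k (to_circle (kc k) w).
Proof.
move=> wk; rewrite /to_wedge; case: pickP => [k' wk'|none].
  have -> // : k' = k; apply/eqP; apply: contraLR wk' => /wk.
  by rewrite leNgt.
rewrite /to_circle excess0 ?arc0; last by rewrite leNgt none.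
exact: lift_base.
Qed.

Lemma to_wedge_cont : continuous to_wedge.
Proof.
(* If a weight exceeds 1 / 2, it does so nearby and keeps the others below 1 / 2, so one formula
   applies. Otherwise all weights stay below 2 / 3 nearby and the map is constant. *)
move=> w0; have [[k wk]|/forallNP wk] := pselect (exists k, 2^-1 < wt w0 (kc k)).
  apply: (@near_continuous _ _ _ (lift k \o to_circle (kc k))).
    by apply: comp_cont; [exact: lift_cont|exact: to_circle_cont].
  have : nbhs w0 ((fun w => wt w (kc k)) @^-1` [set u | 2^-1 < u]).
    by apply: wt_cont; exact: lt_nbhsr.
  apply: filterS => w /= wk'; apply: to_wedge_lift => k' kk'.
  have := @wt_pair_le1 _ _ _ w (kc k) (kc k').
  by rewrite (inj_eq kc_inj) eq_sym => /(_ kk'); lra.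
apply: (@near_continuous _ _ _ (fun=> lift k0 (circle_base R))).
  exact: cst_continuous.
have : forall k, \forall w \near w0, wt w (kc k) < 2 / 3.
  move=> k; have : nbhs w0 ((fun w => wt w (kc k)) @^-1` [set u | u < 2 / 3]).
    apply: wt_cont; apply: lt_nbhsl.
    by have /negP := wk k; rewrite -leNgt; lra.
  by [].
move=> /filter_forall; apply: filterS => w h; rewrite /to_wedge.
by case: pickP => // k; rewrite ltNge ltW.
Qed.

(** If no inner cell has weight above 2 / 3, the round trip is at the origin, and w is on an axis or
    [retract] moves it to one. Near an inner cell, both points are on the axis crossing the line of
    w until the weight reaches 5 / 6, and then on that line. *)
Lemma retract_of_to_adj w : adj (of_wedge (to_wedge w)) (retract w).
Proof.
apply: adj_sym; rewrite /to_wedge; case: pickP => [k wk|none]; last first.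
  rewrite of_wedge_lift of_circle_base.
  have wL := ln_supp w; have [aL|naL] := boolP (is_axis (ln w)).
    exists (ln w); first exact: retract_supp.
    by apply: vtx_supp; move: aL; case: (ln w) => k /= /eqP ->; exact: eqxx.
  exists (axis (ln w)); last by apply: vtx_supp; exact: axis_origin.
  apply: (retract_hub naL wL) => d dh.
  have [dL|dL] := boolP (on_line (ln w) d); last by rewrite (wL _ dL); lra.
  have [||k <-] := @kc_surj d; last by have := negbT (none k); rewrite -leNgt; lra.
  - move: naL dL dh; case: (ln w) => [i|j] /= n0; first by move=> /eqP ->.
    by case: d => a b /= /eqP ->; rewrite -pair_eqE /= eqxx andbT.
  - move: naL dL dh; case: (ln w) => [i|j] /= n0; last by move=> /eqP ->.
    by case: d => a b /= /eqP ->; rewrite -pair_eqE /= eqxx.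
rewrite of_wedge_lift of_circle_arc; set c := kc k.
have c0 : 0 < wt w c by apply: lt_trans wk; lra.
have wL := side_lineP c0.
have Ec : corner_line (side c w <= 0) c = side_line c w by [].
have eE : uval (excess c w) = 3 * wt w c - 2.
  by rewrite clampK //; have := wt_le1 w c; move: wk; rewrite -/c; lra.
have [h|h] := leP (uval (excess c w)) 2^-1.
  exists (axis (side_line c w)); last exact: corner_supp_axis.
  apply: retract_hub => // [|d _].
    by rewrite /side_line; have [? ?] := kc_inner k; case: ifP.
  have [->|dc] := eqVneq d c; first by move: h; rewrite eE; lra.
  by have := wt_pair_le1 w dc; move: wk; rewrite -/c; lra.
exists (side_line c w).
  by move=> d dL; rewrite (wt_retract wL); exact: retract_supp.
by rewrite -Ec; apply: corner_supp; exact: ltW.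
Qed.

Lemma to_of_circle k b (t : I) :
  to_wedge (of_circle (kc k) (arc b t)) = lift k (arc b (clamp (6 * uval t - 5))).
Proof.
rewrite of_circle_arc; set c := kc k; set w := corner b c t.
have /andP[t0 t1] := uvalP t.
have nh k' : (kc k' == hub (corner_line b c)) = false.
  have [] := kc_inner k'; case: (kc k') => x y /= x0 y0.
  by case: b {w} => /=; rewrite -pair_eqE /= ?(negbTE x0) ?(negbTE y0) ?andbF.
have n0 k' : (kc k' == (ord0, ord0)) = false.
  have [] := kc_inner k'; case: (kc k') => x y /= x0 y0.
  by rewrite -pair_eqE /= (negbTE x0).
have wE k' : wt w (kc k') = if uval t <= 2^-1 then 0 else
    (2 * uval t - 1) * (kc k' == c)%:R.
  by rewrite wt_corner nh n0 /= !mulr0 !add0r.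
rewrite (@to_wedge_lift k) => [|k' kk']; last first.
  by rewrite wE (inj_eq kc_inj) (negbTE kk') mulr0; case: ifP => _; lra.
congr (lift k _); rewrite /to_circle -/c.
have -> : excess c w = clamp (6 * uval t - 5).
  rewrite /excess wE; case: (leP (uval t) 2^-1) => t2.
    by rewrite [LHS]clamp_le0; [rewrite [RHS]clamp_le0 //; lra|lra].
  by rewrite eqxx mulr1; congr clamp; lra.
have [t2|t2] := leP (uval t) 2^-1.
  by apply: arc_end; left; rewrite clamp_le0 //; lra.
have wL : supp_on (wt w) (corner_line b c) by exact: corner_supp (ltW t2).
(* At t = 1 the point is the vertex, where [side] is 0 and no longer remembers b; the arcs agree
   there. *)
have [te|tn] := eqVneq (uval t) 1.
  by apply: arc_end; right; rewrite clamp_ge1 // te; lra.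
congr (arc _ _); rewrite /side; move: wL; rewrite /corner_line; clearbody w.
case: (b) => wL.
  by rewrite off_col_row // sub0r oppr_le0 off_row_ge0.
rewrite off_row_col // subr0 off_col_col // wE [uval t <= _]leNgt t2 /= eqxx mulr1.
have t1' : uval t < 1 by rewrite lt_neqAle tn t1.
by apply/negbTE; rewrite -ltNge; lra.
Qed.

Lemma to_of_homotopic : homotopic R (to_wedge \o of_wedge) idfun.
Proof.
(* The round trip reparametrizes each half circle by 6t - 5: the weight of the cell is 2t - 1 on the
   second half of [corner], and 3 (2t - 1) - 2 = 6t - 5. Linear interpolation to the identity fixes
   both ends. *)
pose h (t : I) (z : circle R) : I := clamp
  ((1 - uval t) * uval (clamp (6 * uval (circle_param z) - 5)) +
   uval t * uval (circle_param z)).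
pose K k (t : I) (z : circle R) : W := lift k (arc (- circle_y z <= 0) (h t z)).
have c5 : clamp (6 * 0 - 5) = zero :> I by rewrite clamp_le0 //; lra.
have c6 : clamp (6 * 1 - 5) = one :> I by rewrite clamp_ge1 //; lra.
have h0 t z : circle_param z = zero -> h t z = zero.
  by move=> e; rewrite /h e uval0 c5 uval0 !mulr0 addr0.
have h1 t z : circle_param z = one -> h t z = one.
  by move=> e; rewrite /h e uval1 c6 uval1 !mulr1 subrK.
have ch : continuous (fun z : I * circle R => h z.1 z.2).
  apply: comp_cont; first exact: clamp_continuous.
  have c1 : continuous (fun z : I * circle R => uval z.1).
    by apply: comp_cont; [exact: uval_continuous|exact: fst_cont].
  have c2 : continuous (fun z : I * circle R => uval (circle_param z.2)).
    apply: comp_cont; first exact: uval_continuous.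
    by apply: comp_cont; [exact: circle_param_cont|exact: snd_cont].
  apply: addr_cont; apply: mulr_cont => //; first exact: onem_cont.
  apply: comp_cont; first exact: uval_continuous.
  apply: comp_cont; first exact: clamp_continuous.
  exact: affine_cont.
have KE t k k' : K k t (circle_base R) = K k' t (circle_base R).
  rewrite /K h0; last by rewrite -(arc0 true) circle_param_arc.
  by rewrite !arc0; exact: lift_base.
pose G (z : I * W) : W := uncurry
  (fun t => @wedge_fun 'I_r (fun=> circle R) (fun=> circle_base R) _ (K^~ t)) z.
have cG : continuous G.
  apply: (@wedge_fun_joint_continuous 'I_r (fun=> circle R) (fun=> circle_base R)
    I W K) => [||//|k].
  - exact: finite_finset.
  - by move=> _; exact: closed_circle_base.
  - rewrite (_ : uncurry _ =
        fun z => lift k (arc (- circle_y z.2 <= 0) (h z.1 z.2))).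
      apply: (comp_cont (g := lift k)); first exact: lift_cont.
      apply: arc_paste_cont => //.
        rewrite (_ : (fun z => _) = fun z : I * circle R => -1 * circle_y z.2 + 0).
          apply: affine_cont; apply: comp_cont; last exact: snd_cont.
          exact: circle_y_cont.
        by apply/funext => z; rewrite addr0 mulN1r.
      by move=> z /circle_param_end[/h0|/h1] ->; [left|right].
    by apply/funext => -[].
exists (fun z => G (z.2, z.1)).
have lifted (P : W -> Prop) : (forall k z, P (lift k z)) -> forall w, P w.
  move=> PL w; have : [set: W] w by [].
  by rewrite -wedgeTE => -[k _ [z _ <-]].
split=> [||].
- by apply: comp_cont => //; apply: pair_cont; [exact: snd_cont|exact: fst_cont].
- apply: lifted => k z; rewrite /G /uncurry wedge_lift_funE /=; last exact: KE.
  rewrite of_wedge_lift -{2}(circle_arc z) to_of_circle /K.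
  congr (lift _ (arc _ _)).
  by rewrite /h uval0 subr0 mul1r mul0r addr0 uvalK.
- apply: lifted => k z; rewrite /G /uncurry wedge_lift_funE /=; last exact: KE.
  rewrite /K -{3}(circle_arc z); congr (lift _ (arc _ _)).
  by rewrite /h uval1 subrr mul0r mul1r add0r uvalK.
Qed.

(** The round trip may send a point of an inner line to the origin, off that line, so a
    straight-line homotopy to the identity must be split in two at [retract]. *)
Lemma of_to_homotopic : homotopic R (of_wedge \o to_wedge) idfun.
Proof.
have cft : continuous (of_wedge \o to_wedge).
  by apply: comp_cont; [exact: of_wedge_cont|exact: to_wedge_cont].
apply: (homotopic_trans (g := retract)).
  apply: adj_homotopic => //; first exact: retract_cont.
  exact: retract_of_to_adj.
apply: adj_homotopic; first exact: retract_cont; last exact: retract_adj.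
by move=> ?; exact: cvg_id.
Qed.

End wedge_equivalence.

Lemma rook_wedge_of_circles (R : realType) (p q : nat) : (0 < p)%N -> (0 < q)%N ->
  homotopy_equivalent R (rook R p.+1 q.+1) (wedge_of_circles R (p * q)).
Proof.
move=> p0 q0.
have card : #|{: 'I_p * 'I_q}| = (p * q)%N by rewrite card_prod !card_ord.
pose kc (k : 'I_(p * q)) : 'I_p.+1 * 'I_q.+1 :=
  inner_cell (enum_val (cast_ord (esym card) k)).
have k0 : 'I_(p * q) by exists 0; rewrite muln_gt0 p0.
have kc_inj : injective kc.
  move=> k k' e; apply: (@cast_ord_inj _ _ (esym card)); apply: enum_val_inj.
  apply/eqP; rewrite -pair_eqE; apply/andP; split; apply/eqP.
    by apply: (@lift_inj _ ord0); exact: (congr1 fst e).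
  by apply: (@lift_inj _ ord0); exact: (congr1 snd e).
exists (to_wedge k0 kc), (of_wedge (R := R) kc); split.
- exact: to_wedge_cont.
- exact: of_wedge_cont.
- apply: of_to_homotopic => //.
  move=> [i j] /= i0 j0.
  case: (unliftP ord0 i) i0 => [i' ->|->]; last by rewrite eqxx.
  case: (unliftP ord0 j) j0 => [j' ->|->]; last by rewrite eqxx.
  move=> _ _; exists (cast_ord card (enum_rank (i', j'))).
  by rewrite /kc cast_ordK enum_rankK.
- exact: to_of_homotopic.
Qed.

(** * Configurations of squares *)

Section injections_missing_a_point.
Context {T : finType} {n : nat} (s : 'I_n -> T).
Hypotheses (s_inj : injective s) (card_T : #|T| = n.+1).

Lemma missing_point : exists h, forall k, s k != h.
Proof.
pose A := [set s k | k : 'I_n]%SET.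
have cA : #|A| = n by rewrite card_imset // card_ord.
have : #|~: A| == 1%N.
  by rewrite -(eqn_add2l #|A|) cardsC card_T cA addn1.
move=> /cards1P [h Ah]; exists h => k; apply/eqP => sk.
have : h \in ~: A by rewrite Ah inE.
by rewrite inE -sk imset_f.
Qed.

Lemma sum_missing (V : zmodType) (h : T) (F : T -> V) :
  (forall k, s k != h) -> \sum_k F (s k) = \sum_c F c - F h.
Proof.
move=> sh; pose A := [set s k | k : 'I_n]%SET.
have cA : #|A| = n by rewrite card_imset // card_ord.
have hA : h \notin A by apply/imsetP => -[k _ e]; have := sh k; rewrite -e eqxx.
have AE : A = [set~ h]%SET.
  apply/eqP; rewrite eqEcard; apply/andP; split.
    by apply/fintype.subsetP => c cA'; rewrite !inE; apply: contraNneq hA => <-.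
  by rewrite cardsC1 card_T cA.
rewrite (bigD1 h) //= addrC addrK.
transitivity (\sum_(c in A) F c); last first.
  by rewrite AE; apply: eq_bigl => c; rewrite !inE.
by rewrite big_imset //= => ? ? _ _; exact: s_inj.
Qed.

End injections_missing_a_point.

(** * Rounding and rigidity of packings *)

Section rounding.
Context {R : realType}.

Definition round (up : bool) (x : R) : nat :=
  `|if up then Num.ceil x else Num.floor x|%N.

Lemma natr_abs_int (z : int) : 0 <= z -> `|z|%N%:R = z%:~R :> R.
Proof. by move=> z0; rewrite pmulrn gez0_abs. Qed.

Lemma floorP (x : R) : 0 <= x -> (round false x)%:R <= x < (round false x).+1%:R.
Proof.
move=> x0; rewrite /round -natr1 natr_abs_int ?floor_ge0 //.
by rewrite -[1]/(1%:~R) -intrD floor_itv.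
Qed.

Lemma ceilP (x : R) : 0 <= x -> (round true x)%:R - 1 < x <= (round true x)%:R.
Proof.
move=> x0; rewrite /round natr_abs_int; last by rewrite ceil_ge0; lra.
by have := ceil_itv x; rewrite intrB.
Qed.

Lemma round_inj up (x y : R) : 0 <= x -> 0 <= y -> round up x = round up y ->
  `|x - y| < 1.
Proof.
move=> x0 y0; case: up => e; rewrite ltr_norml.
  by have := ceilP x0; have := ceilP y0; rewrite e; lra.
by have := floorP x0; have := floorP y0; rewrite e -natr1; lra.
Qed.

Lemma round_le up (x : R) m : 0 <= x <= m%:R -> (round up x <= m)%N.
Proof.
move=> /andP[x0 xm]; rewrite -(ler_nat R); case: up.
  rewrite leNgt; apply/negP; rewrite ltr_nat => mk.
  have : m.+1%:R <= (round true x)%:R :> R by rewrite ler_nat.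
  by rewrite -natr1; have := ceilP x0; lra.
by have := floorP x0; lra.
Qed.

Lemma round_mono (x : R) : 0 <= x -> (round false x <= round true x)%N.
Proof.
by move=> x0; rewrite -(ler_nat R); have := ceilP x0; have := floorP x0; lra.
Qed.

Lemma round_eq (x : R) : 0 <= x -> round false x = round true x ->
  x = (round false x)%:R.
Proof. by move=> x0 e; have := ceilP x0; have := floorP x0; rewrite -e; lra. Qed.

Lemma round_nat up m : round up (m%:R : R) = m.
Proof.
have m0 : 0 <= m%:R :> R by rewrite ler0n.
apply/eqP; rewrite eqn_leq; apply/andP; split.
  by apply: round_le; rewrite m0 lexx.
case: up; first by rewrite -(ler_nat R); have := ceilP m0; lra.
by rewrite -ltnS -(ltr_nat R); have := floorP m0; lra.
Qed.

End rounding.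

Section rigidity.
Context {R : realType} {p q n : nat}.
Hypothesis hn : (p.+1 * q.+1)%N = n.+1.

(** With lower left corners as coordinates, a grid of [P.+1] by [Q.+1] cells gives the ranges [0, P]
    and [0, Q]. *)
Definition packed (P Q N : nat) (a b : 'I_N -> R) :=
  [/\ forall k, 0 <= a k <= P%:R, forall k, 0 <= b k <= Q%:R &
      forall k l, k != l -> 1 <= Num.max `|a k - a l| `|b k - b l|].

Lemma packed_swap (P Q N : nat) (a b : 'I_N -> R) :
  packed P Q a b -> packed Q P b a.
Proof. by move=> [ha hb ab]; split=> // k l kl; rewrite maxC ab. Qed.

Variables (a b : 'I_n -> R).
Hypothesis ab : packed p q a b.

Let a0 k : 0 <= a k. Proof. by have [h _ _] := ab; have /andP[] := h k. Qed.
Let b0 k : 0 <= b k. Proof. by have [_ h _] := ab; have /andP[] := h k. Qed.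

Definition cell_at (s t : bool) (k : 'I_n) : 'I_p.+1 * 'I_q.+1 :=
  (inord (round s (a k)), inord (round t (b k))).

Lemma cell_at1 s t k : (cell_at s t k).1 = round s (a k) :> nat.
Proof.
by rewrite inordK // ltnS; apply: round_le; have [h _ _] := ab; exact: h.
Qed.

Lemma cell_at2 s t k : (cell_at s t k).2 = round t (b k) :> nat.
Proof.
by rewrite inordK // ltnS; apply: round_le; have [_ h _] := ab; exact: h.
Qed.

Lemma cell_at_inj s t : injective (cell_at s t).
Proof.
move=> k l e; apply/eqP; apply: contraT => kl; have [_ _ /(_ k l kl)] := ab.
have e1 : round s (a k) = round s (a l) by rewrite -(cell_at1 s t) e cell_at1.
have e2 : round t (b k) = round t (b l) by rewrite -(cell_at2 s t) e cell_at2.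
by rewrite le_max !leNgt (round_inj _ _ e1) // (round_inj _ _ e2).
Qed.

Lemma card_cells : #|{: 'I_p.+1 * 'I_q.+1}| = n.+1.
Proof. by rewrite card_prod !card_ord. Qed.

Lemma hole_exists s t : exists h, forall k, cell_at s t k != h.
Proof. exact: missing_point (@cell_at_inj s t) card_cells. Qed.

(* Rounding [a] up or down does not change the rows, and in a row that is full
   for both roundings the rounded coordinates have the same sum. *)
Lemma hole_row_floor_ceil t h h' :
  (forall k, cell_at false t k != h) -> (forall k, cell_at true t k != h') ->
  h.2 = h'.2 /\
  forall k, round false (a k) != round true (a k) -> (cell_at false t k).2 = h.2.
Proof.
move=> hh hh'.
have S (s : bool) h0 (F : _ -> int) (e : forall k, cell_at s t k != h0) :=
  sum_missing (@cell_at_inj s t) card_cells F e.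
have e2 : h.2 = h'.2.
  have := S _ _ (fun c => (c.2 == h.2)%:Z) hh.
  have := S _ _ (fun c => (c.2 == h.2)%:Z) hh'.
  have -> : \sum_k ((cell_at true t k).2 == h.2)%:Z =
            \sum_k ((cell_at false t k).2 == h.2)%:Z by [].
  move=> -> /addrI /oppr_inj; rewrite eqxx.
  by case: eqP => // ->.
split=> // k kk; apply/eqP; apply: contraT => kh.
pose j := (cell_at false t k).2.
pose F (c : 'I_p.+1 * 'I_q.+1) : int := if c.2 == j then (c.1 : nat)%:Z else 0.
have Fh : F h = 0 by rewrite /F ifF // eq_sym; exact/negbTE.
have Fh' : F h' = 0 by rewrite /F -e2 ifF // eq_sym; exact/negbTE.
have := S _ _ F hh'; have := S _ _ F hh; rewrite Fh Fh' => <- /eqP.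
 rewrite -subr_eq0 -sumrB psumr_eq0; last first.
  move=> l _; rewrite /F; case: ifP => // _.
  by rewrite !cell_at1 subr_ge0 lez_nat round_mono.
move=> /allP /(_ k); rewrite mem_index_enum => /(_ isT) /=.
rewrite /F !eqxx !cell_at1 subr_eq0 eqz_nat eq_sym.
by rewrite (negbTE kk).
Qed.

End rigidity.

(** If some [a k] is not an integer, then k is in the row of the hole whether b is rounded down or
    up, so rounding up does not lower the hole. The sum of the rounded b is a fixed total minus the
    row of the hole, hence does not grow on rounding up; as no term decreases, every b is an
    integer. *)
Lemma rigid (R : realType) (p q n : nat) (a b : 'I_n -> R) :
  (p.+1 * q.+1)%N = n.+1 -> packed p q a b ->
  (forall k, a k = (round false (a k))%:R) \/
  (forall k, b k = (round false (b k))%:R).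
Proof.
move=> hn ab; have [ha hb _] := ab.
have b0 k : 0 <= b k by have /andP[] := hb k.
have a0 k : 0 <= a k by have /andP[] := ha k.
have [/existsP[k kk]|/existsPn ka] :=
  boolP [exists k, round false (a k) != round true (a k)]; last first.
  by left=> k; apply: round_eq => //; apply/eqP; have := ka k; rewrite negbK.
right.
have [h hh] := hole_exists hn ab false false.
have [h' hh'] := hole_exists hn ab false true.
have [g gg] := hole_exists hn ab true false.
have [g' gg'] := hole_exists hn ab true true.
have [_ /(_ k kk) e] := hole_row_floor_ceil hn ab hh gg.
have [_ /(_ k kk) e'] := hole_row_floor_ceil hn ab hh' gg'.
have hle : (h.2 <= h'.2)%N.
  by rewrite -e -e' !(cell_at2 ab); exact: round_mono.
pose F (c : 'I_p.+1 * 'I_q.+1) : int := (c.2 : nat)%:Z.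
have S := sum_missing (@cell_at_inj _ _ _ _ _ _ ab false false)
  (card_cells hn) F hh.
have S' := sum_missing (@cell_at_inj _ _ _ _ _ _ ab false true)
  (card_cells hn) F hh'.
have bmono l : 0 <= F (cell_at a b false true l) - F (cell_at a b false false l).
  by rewrite /F !(cell_at2 ab) subr_ge0 lez_nat round_mono.
have : \sum_l (F (cell_at a b false true l) - F (cell_at a b false false l)) == 0.
  rewrite eq_le sumr_ge0 // andbT sumrB S S' opprB addrC addrA subrK subr_le0.
  by rewrite /F lez_nat.
rewrite psumr_eq0 // => /allP bb l; apply: round_eq => //.
have := bb l; rewrite mem_index_enum => /(_ isT) /=.
by rewrite subr_eq0 /F !(cell_at2 ab) eqz_nat eq_sym => /eqP.
Qed.

Ltac case_minmax := repeat match goal with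
  | |- context [Order.min ?u ?v] =>
    lazymatch v with context [Order.min _ _] => fail | _ => case: (leP u v) => ? end
  | |- context [Order.max ?u ?v] =>
    lazymatch v with context [Order.min _ _] => fail | _ => case: (leP u v) => ? end
  end.

(** * Tent functions *)

Section tent_function.
Context {R : realType}.

Definition tent (x : R) : R := Num.max 0 (1 - `|x|).

Definition clip (x : R) : R := Num.max 0 (Num.min 1 x).

Lemma tent_eq0 x : 1 <= `|x| -> tent x = 0.
Proof. by move=> h; rewrite /tent max_l //; lra. Qed.

Lemma tent_le1 x : tent x <= 1.
Proof. by rewrite /tent ge_max ler01 /=; have := normr_ge0 x; lra. Qed.

Lemma dist_nat_ge1 (m j : nat) : m != j -> 1 <= `|m%:R - j%:R : R|.
Proof.
rewrite neq_ltn => /orP[] h; [rewrite distrC|];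
  by rewrite ger0_norm ?subr_ge0 ?ler_nat ?(ltnW h) // -natrB ?(ltnW h) //
    ler1n subn_gt0.
Qed.

Lemma tent_nat (m j : nat) : tent (m%:R - j%:R) = (m == j)%:R.
Proof.
have [->|mj] := eqVneq m j; last exact/tent_eq0/dist_nat_ge1.
by rewrite /tent subrr normr0 subr0 max_r.
Qed.

Lemma tent_shift (v : R) (m j : nat) : 0 <= v <= 1 ->
  tent (m%:R + v - j%:R) = (1 - v) * (m == j)%:R + v * (m.+1 == j)%:R.
Proof.
move=> /andP[v0 v1]; have [->|mj] := eqVneq m j.
  rewrite (_ : j.+1 == j = false) ?gtn_eqF // mulr1 mulr0 addr0.
  rewrite (_ : _ + v - _ = v); last by ring.
  by rewrite /tent ger0_norm // max_r //; lra.
have [<-|m1j] := eqVneq m.+1 j.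
  rewrite mulr0 add0r mulr1 -natr1 (_ : _ - _ = v - 1); last by ring.
  by rewrite /tent ler0_norm ?subr_le0 // max_r; lra.
rewrite !mulr0 addr0; apply: tent_eq0.
move: mj; rewrite neq_ltn => /orP[] h.
  have : m.+2%:R <= j%:R :> R by rewrite ler_nat ltn_neqAle m1j.
  by rewrite -2!natr1 ler_normr => h'; apply/orP; right; lra.
have : j.+1%:R <= m%:R :> R by rewrite ler_nat.
by rewrite -natr1 ler_normr => h'; apply/orP; left; lra.
Qed.

Lemma sum_tent (x : R) (m : nat) : 0 <= x ->
  \sum_(i < m) tent (x - i%:R) = clip (m%:R - x).
Proof.
move=> x0; elim: m => [|m IH].
  by rewrite big_ord0 /clip; case_minmax; lra.
rewrite big_ord_recr /= IH -natr1 /clip /tent.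
by have [h|h] := leP 0 (x - m%:R);
  [rewrite ger0_norm //|rewrite ltr0_norm //]; case_minmax; lra.
Qed.

Lemma sum_tent_all (x : R) (m : nat) : 0 <= x <= m%:R ->
  \sum_(i < m.+1) tent (x - i%:R) = 1.
Proof.
by move=> /andP[x0 xm]; rewrite sum_tent // /clip -natr1; case_minmax; lra.
Qed.

(** At most two points at mutual distance at least 1 lie within distance less than 1 of the origin,
    and then the sum of their distances to it is at least 1. *)
Lemma sum_tent_le1 (I : finType) (S : pred I) (f : I -> R) :
  (forall k l, S k -> S l -> k != l -> 1 <= `|f k - f l|) ->
  \sum_(k | S k) tent (f k) <= 1.
Proof.
move=> far.
have [[k [Sk fk]]|none] := pselect (exists k, S k /\ `|f k| < 1); last first.
  rewrite big1 ?ler01 // => k Sk; apply: tent_eq0; rewrite leNgt.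
  by apply/negP => fk; apply: none; exists k.
rewrite (bigD1 k) //=.
have [[l [Sl lk fl]]|none] := pselect (exists l, [/\ S l, l != k & `|f l| < 1]).
  rewrite (bigD1 l) ?Sl //= big1 ?addr0; last first.
    move=> m /andP[/andP[Sm mk] ml]; apply: tent_eq0; rewrite leNgt.
    apply/negP => fm; have := far _ _ Sm Sk mk; have := far _ _ Sm Sl ml.
    have := far _ _ Sl Sk lk; move: fm fl fk; rewrite !ltr_norml !ler_normr.
    by move=> /andP[? ?] /andP[? ?] /andP[? ?] /orP[?|?] /orP[?|?] /orP[?|?]; lra.
  rewrite /tent !max_r ?subr_ge0 ?(ltW fk) ?(ltW fl) //.
  have := far _ _ Sl Sk lk; have := ler_normB (f l) (f k); lra.
rewrite big1 ?addr0 ?tent_le1 // => l /andP[Sl lk].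
apply: tent_eq0; rewrite leNgt; apply/negP => fl; apply: none.
by exists l.
Qed.

End tent_function.

Section weights_of_squares.
Context {R : realType}.

(* The part of the cell [c] left uncovered, in a piecewise bilinear sense. *)
Definition theta (p q n : nat) (a b : 'I_n -> R) (c : 'I_p * 'I_q) : R :=
  1 - \sum_k tent (a k - c.1%:R) * tent (b k - c.2%:R).

Lemma theta_swap (p q n : nat) (a b : 'I_n -> R) (i : 'I_p) (j : 'I_q) :
  theta b a (j, i) = theta a b (i, j).
Proof. by congr (_ - _); apply: eq_bigr => k _; rewrite mulrC. Qed.

(* The displacement to the right of the [m]-th square of row [j]. *)
Definition shift (p q : nat) (w : 'I_p * 'I_q -> R) (j : 'I_q) (m : nat) : R :=
  \sum_(i < p | (i <= m)%N) w (i, j).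

(** The integer parts of the points are distinct naturals below the integer part of x. *)
Lemma count_far (n : nat) (S : {set 'I_n}) (f : 'I_n -> R) (x : R) :
  (forall l, 0 <= f l) ->
  (forall k l, k \in S -> l \in S -> k != l -> 1 <= `|f k - f l|) ->
  (forall l, l \in S -> f l <= x - 1) -> 0 <= x -> #|S|%:R <= x.
Proof.
move=> f0 far fx x0; apply: le_trans (_ : (round false x)%:R <= x); last first.
  by have /andP[] := floorP x0.
rewrite ler_nat cardE -(size_map (round false \o f)) -[leqRHS](size_iota 0).
apply: uniq_leq_size.
  rewrite map_inj_in_uniq ?enum_uniq // => k l; rewrite !mem_enum => kS lS /= e.
  apply/eqP; apply: contraT => kl; have := far _ _ kS lS kl.
  by rewrite leNgt (round_inj _ _ e).
move=> i /mapP[l]; rewrite mem_enum => lS ->; rewrite mem_iota /= add0n.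
have := fx _ lS; have := floorP (f0 l); have := floorP x0.
by rewrite -(ltr_nat R) -natr1; lra.
Qed.

End weights_of_squares.

(** * Configurations aligned in rows, and their reconstruction from the weights *)

Section row_configurations.
Context {R : realType} {p q n : nat}.
Hypothesis hn : (p.+1 * q.+1)%N = n.+1.
Variables (a b : 'I_n -> R).
Hypotheses (ab : packed p q a b) (b_int : forall k, b k = (round false (b k))%:R).
Local Notation cell := ('I_p.+1 * 'I_q.+1)%type.

Let a0 k : 0 <= a k. Proof. by have [h _ _] := ab; have /andP[] := h k. Qed.
Let ap k : a k <= p%:R. Proof. by have [h _ _] := ab; have /andP[] := h k. Qed.
Let row k : 'I_q.+1 := (cell_at (p := p) a b false false k).2.

Let row_val k : b k = (row k)%:R.
Proof. by rewrite b_int /row (cell_at2 ab). Qed.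

Let row_far k l : row k = row l -> k != l -> 1 <= `|a k - a l|.
Proof.
move=> rkl kl; have [_ _ /(_ k l kl)] := ab.
by rewrite le_max !row_val rkl subrr normr0 ler10 orbF.
Qed.

Let row_tent k (j : 'I_q.+1) : tent (b k - j%:R) = (row k == j)%:R.
Proof. by rewrite row_val tent_nat. Qed.

Let thetaE (i : 'I_p.+1) j : theta a b (i, j) =
  1 - \sum_(k | row k == j) tent (a k - i%:R).
Proof.
rewrite /theta /=; congr (_ - _); rewrite [RHS]big_mkcond /=.
by apply: eq_bigr => k _; rewrite row_tent; case: eqP; rewrite ?mulr1 ?mulr0.
Qed.

Let theta_ge0 (c : cell) : 0 <= theta a b c.
Proof.
case: c => i j; rewrite thetaE subr_ge0; apply: sum_tent_le1 => k l kj lj kl.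
rewrite (_ : _ - _ = a k - a l); last by ring.
by apply: row_far => //; rewrite (eqP kj) (eqP lj).
Qed.

Let hole : cell := projT1 (cid (hole_exists hn ab false false)).
Let Y : 'I_q.+1 := hole.2.

Let row_size j : \sum_k (row k == j)%:R = p.+1%:R - (j == Y)%:R :> R.
Proof.
have hh := projT2 (cid (hole_exists hn ab false false)).
have := sum_missing (@cell_at_inj _ _ _ _ _ _ ab false false) (card_cells hn)
  (fun c => (c.2 == j)%:R : R) hh.
move=> ->; rewrite (eq_sym j); congr (_ - _).
rewrite -(pair_bigA _ (fun (i : 'I_p.+1) k => (k == j)%:R)) /=.
rewrite (eq_bigr (fun=> 1)) ?sumr_const ?card_ord // => i _.
by rewrite (bigD1 j) //= eqxx big1 ?addr0 // => k /negbTE ->.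
Qed.

(** The tents of a square add up to 1 along its row, so the sum is the number of cells minus the
    number of squares. With nonnegativity this confines the weights to the row of the hole. *)
Let theta_row_sum (j : 'I_q.+1) :
  \sum_(i < p.+1) theta a b (i, j) = (j == Y)%:R :> R.
Proof.
under eq_bigr do rewrite thetaE.
rewrite sumrB sumr_const card_ord exchange_big /= (eq_bigr (fun=> 1)).
  rewrite (_ : \sum_(k | row k == j) 1 = \sum_k (row k == j)%:R :> R).
    by rewrite row_size opprB addrC subrK.
  by rewrite big_mkcond /=; apply: eq_bigr => k _; case: eqP.
by move=> k _; apply: sum_tent_all; rewrite a0 ap.
Qed.

Let theta_supp : supp_on (theta a b : cell -> R) (inr Y).
Proof.
case=> i j /= jY; have := theta_row_sum j; rewrite (negbTE jY) => /eqP.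
rewrite psumr_eq0 => [/allP /(_ i)|? _]; last exact: theta_ge0.
by rewrite mem_index_enum => /(_ isT) /eqP.
Qed.

Let theta_rook : rook_set (theta a b : cell -> R).
Proof.
split=> //; last by exists (inr Y).
rewrite -(pair_bigA _ (fun i j => theta a b (i, j))) /= exchange_big /=.
under eq_bigr do rewrite theta_row_sum.
by rewrite (bigD1 Y) //= eqxx big1 ?addr0 // => j /negbTE ->.
Qed.

Let left_of k := [set l | (row l == row k) && (a l < a k)]%SET.
Let right_of k := [set l | (row l == row k) && (a k < a l)]%SET.

Let left_far k l : l \in left_of k -> a l <= a k - 1.
Proof.
rewrite inE => /andP[/eqP rl lk].
have lk' : l != k by apply: contraTneq lk => ->; rewrite ltxx.
by have := row_far rl lk'; rewrite ler0_norm; [lra|rewrite subr_le0 ltW].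
Qed.

Let right_far k l : l \in right_of k -> a k + 1 <= a l.
Proof.
rewrite inE => /andP[/eqP rl lk].
have lk' : l != k by apply: contraTneq lk => ->; rewrite ltxx.
by have := row_far rl lk'; rewrite ger0_norm; [lra|rewrite subr_ge0 ltW].
Qed.

Let card_sum (P : pred 'I_n) : #|[set l | P l]%SET|%:R = \sum_l (P l)%:R :> R.
Proof.
rewrite -sum1_card natr_sum big_mkcond /=; apply: eq_bigr => l _.
by rewrite inE; case: (P l).
Qed.

Let split_row k l : (row l == row k)%:R =
  ((row l == row k) && (a l < a k))%:R + (l == k)%:R +
  ((row l == row k) && (a k < a l))%:R :> R.
Proof.
have [->|lk] := eqVneq l k; first by rewrite ltxx eqxx !andbF addr0 add0r.
have [rl|//] := eqVneq (row l) (row k); last by rewrite !addr0.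
have := row_far rl lk; case: ltgtP => [h|h|->] /=; rewrite ?addr0 ?add0r //.
by rewrite subrr normr0 ler10.
Qed.

Let row_count k :
  #|left_of k|%:R + 1 + #|right_of k|%:R = p.+1%:R - (row k == Y)%:R :> R.
Proof.
rewrite -row_size !card_sum.
rewrite [RHS](eq_bigr _ (fun l _ => split_row k l)) !big_split /=.
congr (_ + _ + _); rewrite (bigD1 k) //= eqxx big1 ?addr0 // => l /negbTE -> //.
Qed.

Let left_le k : #|left_of k|%:R <= a k.
Proof.
apply: (@count_far _ n _ a) => // [l l'|]; last exact: left_far.
rewrite !inE => /andP[/eqP rl _] /andP[/eqP rl' _]; apply: row_far.
by rewrite rl.
Qed.

Let right_le k : #|right_of k|%:R <= p%:R - a k.
Proof.
apply: (@count_far _ n _ (fun l => p%:R - a l)).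
- by move=> l; rewrite subr_ge0.
- move=> l l'; rewrite !inE => /andP[/eqP rl _] /andP[/eqP rl' _] ll'.
  rewrite (_ : _ - _ = a l' - a l); last by ring.
  by apply: row_far; rewrite ?rl // eq_sym.
- by move=> l /right_far; lra.
- by rewrite subr_ge0.
Qed.

Let le_left k : a k <= #|left_of k|%:R + 1.
Proof.
have := row_count k; have := right_le k; rewrite -natr1.
by case: (row k == Y); rewrite /=; lra.
Qed.

Let left_ltp k : (#|left_of k| < p.+1)%N.
Proof. by rewrite ltnS -(ler_nat R); apply: le_trans (left_le k) (ap k). Qed.

(** Let r be the number of squares to the left. By [sum_tent] the squares of the row cover of the
    cells 0 to r: 1 for each square on the left, r + 1 - a k for k itself, and 0 for those on the
    right. What remains of r + 1 is a k - r. *)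
Let shift_left k : shift (theta a b : cell -> R) (row k) #|left_of k| =
  a k - #|left_of k|%:R.
Proof.
set r := #|left_of k|; have rp := left_ltp k; rewrite -/r in rp.
have rk : r%:R <= a k := left_le k.
have kr : a k <= r%:R + 1 := le_left k.
pose F (i : nat) : R := 1 - \sum_(l | row l == row k) tent (a l - i%:R).
rewrite /shift (eq_bigr (fun i : 'I_p.+1 => F i)); last first.
  by move=> i _; exact: thetaE.
rewrite -(big_ord_widen p.+1 F rp) sumrB sumr_const card_ord exchange_big /=.
under eq_bigr do rewrite sum_tent //.
rewrite big_mkcond /= (eq_bigr (fun l =>
  ((row l == row k) && (a l < a k))%:R + (l == k)%:R * (r%:R + 1 - a k))).
  rewrite big_split /= -card_sum -/(left_of k) -/r (bigD1 k) //= eqxx.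
  rewrite big1 => [|l /negbTE ->]; last by rewrite mul0r.
  by rewrite -natr1 mul1r addr0; ring.
move=> l _; rewrite -natr1 /clip; have [->|lk] := eqVneq l k.
  by rewrite !eqxx ltxx /=; case_minmax; lra.
have [rl|_] := eqVneq (row l) (row k); last by rewrite /= mul0r addr0.
have [alk|akl|e] := ltgtP (a l) (a k).
- have : a l <= a k - 1 by apply: left_far; rewrite inE rl eqxx.
  by rewrite /= mul0r => ?; case_minmax; lra.
- have : a k + 1 <= a l by apply: right_far; rewrite inE rl eqxx.
  by rewrite /= mul0r => ?; case_minmax; lra.
- by have := row_far rl lk; rewrite e subrr normr0 ler10.
Qed.

(** Squares are named by their rank from the left, so the missing name is always the last cell of
    the row, wherever the gap is. The positions depend only on the weights and on s: this gives
    injectivity up to relabelling. *)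
Lemma row_normal_form : exists (j : 'I_q.+1) (s : 'I_n -> cell),
  [/\ rook_set (theta a b : cell -> R), supp_on (theta a b : cell -> R) (inr j),
      injective s, forall k, s k != (ord_max, j) &
      forall k, a k = (s k).1%:R + shift (theta a b : cell -> R) (s k).2 (s k).1 /\
                b k = (s k).2%:R].
Proof.
pose s k : cell := (inord #|left_of k|, row k).
have s1 k : (s k).1 = #|left_of k| :> nat by rewrite inordK.
exists Y, s; split=> // [k l e|k|k].
- apply/eqP; apply: contraT => kl.
  have rkl : row k = row l by exact: (congr1 snd e).
  wlog akl : k l e kl rkl / a k < a l.
    move=> h; have [?|?|akl] := ltgtP (a k) (a l); first exact: (h k l).
      by apply: (h l k) => //; rewrite eq_sym.
    by have := row_far rkl kl; rewrite akl subrr normr0 ler10.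
  have : left_of k \proper left_of l.
    apply/properP; split.
      apply/fintype.subsetP => m; rewrite !inE rkl => /andP[-> /=] mk.
      exact: lt_trans mk akl.
    by exists k; rewrite !inE ?rkl ?eqxx ?ltxx.
  by move=> /proper_card; rewrite -!s1 e ltnn.
- apply/eqP => e; have := row_count k; have := ler0n R #|right_of k|.
  have -> : row k = Y by exact: (congr1 snd e).
  have -> : #|left_of k| = p by rewrite -s1 e.
  by rewrite eqxx /= -natr1; lra.
- by rewrite s1 shift_left row_val; split=> //; ring.
Qed.

End row_configurations.

(** * Squares with prescribed weights *)

Section squares_of_weights.
Context {R : realType} {p q n : nat}.
Hypothesis hn : (p.+1 * q.+1)%N = n.+1.
Local Notation cell := ('I_p.+1 * 'I_q.+1)%type.
Variables (w : rook R p.+1 q.+1) (j : 'I_q.+1) (s : 'I_n -> cell).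
Hypotheses (wj : supp_on (wt w) (inr j)) (s_inj : injective s)
  (sj : forall k, s k != (ord_max, j)).

Lemma shift_ge0 j' m : 0 <= shift (wt w) j' m.
Proof. by apply: sumr_ge0 => i _; exact: wt_ge0. Qed.

Lemma shift_mono j' m m' : (m <= m')%N -> shift (wt w) j' m <= shift (wt w) j' m'.
Proof.
move=> mm'; rewrite /shift big_mkcond [leRHS]big_mkcond; apply: ler_sum => i _.
case: ifP => [im|_]; first by rewrite (leq_trans im mm').
by case: ifP => _ //; exact: wt_ge0.
Qed.

Lemma shift_off j' m : j' != j -> shift (wt w) j' m = 0.
Proof. by move=> jj; apply: big1 => i _; exact: wj. Qed.

Lemma shift_max : shift (wt w) j p = 1.
Proof.
rewrite -(wt_sum w) (eq_bigr (fun c => wt w (c.1, c.2))) => [|[]//].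
rewrite -(pair_bigA _ (fun i j => wt w (i, j))) /= exchange_big /=.
rewrite (bigD1 j) //= [X in _ + X]big1 ?addr0; last first.
  by move=> j' jj; apply: big1 => i _; exact: wj.
by apply: eq_bigl => i; rewrite -ltnS ltn_ord.
Qed.

Lemma shift_le1 j' m : shift (wt w) j' m <= 1.
Proof.
have [->|jj] := eqVneq j' j; last by rewrite shift_off.
have [mp|pm] := leqP m p; first by rewrite -shift_max; exact: shift_mono.
suff -> : shift (wt w) j m = shift (wt w) j p by rewrite shift_max.
rewrite /shift; apply: eq_bigl => i; have ip : (i <= p)%N by rewrite -ltnS.
by rewrite ip (leq_trans ip (ltnW pm)).
Qed.

Definition square_x k : R := (s k).1%:R + shift (wt w) (s k).2 (s k).1.
Definition square_y k : R := (s k).2%:R.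

Lemma squares_packed : packed p q square_x square_y.
Proof.
split=> [k|k|k l kl].
- rewrite /square_x addr_ge0 ?ler0n ?shift_ge0 //=.
  case e : (s k) => [i j'] /=; have ip : (i <= p)%N by rewrite -ltnS.
  have [e'|jj] := eqVneq j' j; last by rewrite shift_off // addr0 ler_nat.
  have : (i < p)%N.
    rewrite ltn_neqAle ip andbT; apply: contraNneq (sj k) => ei.
    by rewrite e e' -pair_eqE /= eqxx andbT; apply/eqP/val_inj.
  by rewrite -(ler_nat R) -natr1; have := shift_le1 j' i; lra.
- by rewrite /square_y ler0n ler_nat -ltnS ltn_ord.
- rewrite le_max /square_x /square_y.
  have : s k != s l by rewrite (inj_eq s_inj).
  case: (s k) => i i'; case: (s l) => m m' /=; rewrite -pair_eqE /= => im.
  have [e|im'] := eqVneq i' m'; last by rewrite (dist_nat_ge1 im') orbT.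
  move: im; rewrite e eqxx andbT => im.
  apply/orP; left; wlog lim : i m im / (i < m)%N.
    move=> h; move: (im); rewrite -(inj_eq val_inj) neq_ltn => /orP[|] lim.
      exact: h.
    by rewrite distrC; apply: h => //; rewrite eq_sym.
  rewrite distrC ger0_norm; have := shift_mono m' (ltnW lim);
    by move: lim; rewrite -(ler_nat R) -natr1; lra.
Qed.

(** By [tent_shift], square i of row j covers 1 - shift i of cell i and its left neighbour covers
    shift (i - 1). The rest is the increment of the shift, which is the weight of the cell. *)
Lemma theta_squares : theta square_x square_y =1 wt w.
Proof.
case=> i i'; rewrite /theta /=.
pose G (c : cell) := tent (c.1%:R + shift (wt w) c.2 c.1 - i%:R) *
  tent (c.2%:R - i'%:R).
rewrite -[\sum_k _]/(\sum_k G (s k)) (sum_missing s_inj (card_cells hn) G sj).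
rewrite (eq_bigr (fun c => G (c.1, c.2))) => [|[]//].
rewrite -(pair_bigA _ (fun i j => G (i, j))) /=.
have GE m (m' : 'I_q.+1) : G (m, m') = ((1 - shift (wt w) m' m) * (m == i)%:R +
    shift (wt w) m' m * (m.+1 == i)%:R) * (m' == i')%:R.
  by rewrite /G /= tent_nat tent_shift // shift_ge0 shift_le1.
have -> : \sum_m \sum_m' G (m, m') = \sum_(m < p.+1)
    ((1 - shift (wt w) i' m) * (m == i)%:R + shift (wt w) i' m * (m.+1 == i)%:R).
  apply: eq_bigr => m _; rewrite (bigD1 i') //= GE eqxx mulr1 big1 ?addr0 //.
  by move=> m' /negbTE mi; rewrite GE mi mulr0.
rewrite big_split /= (bigD1 i) //= eqxx mulr1 big1 ?addr0; last first.
  by move=> m /negbTE ->; rewrite mulr0.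
have [ei|ei] := eqVneq i' j; last first.
  rewrite !shift_off // GE [j == i']eq_sym (negbTE ei) mulr0 !subr0.
  rewrite big1 ?addr0 ?subrr; last by move=> m _; rewrite shift_off // mul0r.
  by rewrite (wj (c := (i, i'))).
(* The term of the missing square is 0: displaced by 1, the last square of the row would leave the
   grid. *)
rewrite GE ei eqxx mulr1 shift_max subrr mul0r add0r mul1r.
rewrite [(_.+1 == _)]gtn_eqF // subr0.
have shiftS : shift (wt w) j i =
    wt w (i, j) + \sum_(m < p.+1 | (m < i)%N) wt w (m, j).
  rewrite /shift (bigD1 i) //=; congr (_ + _); apply: eq_bigl => m.
  by rewrite ltn_neqAle andbC.
have -> : \sum_(m < p.+1) shift (wt w) j m * (m.+1 == i)%:R =
    \sum_(m < p.+1 | (m < i)%N) wt w (m, j).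
  case: i {shiftS G GE ei} => [[|i] ip] /=.
    by rewrite !big1 // => m _; rewrite mulr0.
  rewrite (bigD1 (Ordinal (ltnW ip))) //= eqxx mulr1 big1 ?addr0.
    by apply: eq_bigl => m.
  by move=> m; rewrite -(inj_eq val_inj) /= eqSS => /negbTE ->; rewrite mulr0.
by rewrite shiftS; ring.
Qed.

End squares_of_weights.

(** * Compactness and continuity of inverses *)

Lemma compact_set_type (Y : topologicalType) (A : set Y) :
  compact A -> compact [set: set_type A].
Proof.
move=> cA F PF _.
have FA : (set_val @ F) A.
  have : F (set_val @^-1` A) by apply: filterE => z; exact: (set_valP z).
  by [].
have [y [Ay Fy]] := cA _ (fmap_proper_filter set_val PF) FA.
exists (exist _ y (mem_set Ay)); split=> // U V FU [V' [[B oB <-] /= By] BV].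
have FU' : (set_val @ F) (set_val @` U).
  have : F (set_val @^-1` (set_val @` U)).
    by apply: filterS FU => u Uu; exists u.
  by [].
have [_ [[u Uu <-] Bu]] := Fy _ _ FU' (open_nbhs_nbhs (conj oB By)).
by exists u; split=> //; exact: BV.
Qed.

Lemma compact_hausdorff_inverse (X Y : topologicalType) (f : X -> Y) (g : Y -> X) :
  compact [set: X] -> hausdorff_space Y -> continuous f ->
  cancel f g -> cancel g f -> continuous g.
Proof.
move=> cX hY cf fK gK; apply/continuous_closedP => C clC.
rewrite (_ : g @^-1` C = f @` C).
  apply: compact_closed => //; apply: continuous_compact.
    exact: continuous_subspaceT.
  exact: subclosed_compact clC cX _.
apply/seteqP; split=> [y Cy|_ [x Cx <-]] /=; last by rewrite fK.
by exists (g y).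
Qed.

Lemma closed_forall (X : topologicalType) (T : Type) (A : T -> set X) :
  (forall i, closed (A i)) -> closed [set x | forall i, A i x].
Proof.
move=> cA; rewrite (_ : [set x | _] = \bigcap_i A i); first exact: closed_bigI.
by apply/seteqP; split=> x Ax i; [move=> _; exact: Ax|exact: (Ax i I)].
Qed.

Lemma closed_implies (X : topologicalType) (P : Prop) (A : set X) :
  closed A -> closed [set x | P -> A x].
Proof.
move=> cA; have [p|np] := pselect P.
  by rewrite (_ : [set x | _] = A) //; apply/seteqP; split=> x; [exact|move=> Ax _].
rewrite (_ : [set x | _] = setT); first exact: closedT.
by apply/seteqP; split=> x // _ /np.
Qed.

Section enumerating_injections.
Context {T : finType} {n : nat}.
Hypothesis card_T : #|T| = n.+1.

Lemma missing_surj (s : 'I_n -> T) (h c : T) : injective s ->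
  (forall k, s k != h) -> c != h -> exists k, s k = c.
Proof.
move=> s_inj sh ch; apply: contrapT => /forallNP sc.
have := sum_missing s_inj card_T (fun d => (d == c)%:Z) sh.
rewrite big1 => [|k _]; last by case: eqP => // /sc.
rewrite (bigD1 c) //= eqxx big1 => [|d /negbTE -> //].
by rewrite eq_sym (negbTE ch).
Qed.

Lemma missing_relabel (s t : 'I_n -> T) (h : T) : injective s -> injective t ->
  (forall k, s k != h) -> (forall k, t k != h) ->
  exists u : 'S_n, forall k, t k = s (u k).
Proof.
move=> s_inj t_inj sh th.
pose u k := projT1 (cid (missing_surj s_inj sh (th k))).
have uE k : s (u k) = t k := projT2 (cid (missing_surj s_inj sh (th k))).
have u_inj : injective u by move=> k l kl; apply: t_inj; rewrite -!uE kl.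
by exists (perm u_inj) => k; rewrite permE uE.
Qed.

Lemma missing_exists (h : T) :
  exists2 s : 'I_n -> T, injective s & forall k, s k != h.
Proof.
have cn : #|[set~ h]%SET| = n by rewrite cardsC1 card_T.
exists (fun k => enum_val (cast_ord (esym cn) k)).
  by move=> k l /enum_val_inj /cast_ord_inj.
by move=> k; have := enum_valP (cast_ord (esym cn) k); rewrite !inE.
Qed.

End enumerating_injections.

(** * Existence of squares with given weights and uniqueness up to relabelling *)

Lemma card_cells_swap (p q n : nat) :
  (p.+1 * q.+1)%N = n.+1 -> (q.+1 * p.+1)%N = n.+1.
Proof. by rewrite mulnC. Qed.

Lemma row_relabel (R : realType) (p q n : nat) (a b a' b' : 'I_n -> R) :
  (p.+1 * q.+1)%N = n.+1 -> packed p q a b -> packed p q a' b' ->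
  (forall k, b k = (round false (b k))%:R) ->
  (forall k, b' k = (round false (b' k))%:R) ->
  (forall c : 'I_p.+1 * 'I_q.+1, theta a b c = theta a' b' c) ->
  exists u : 'S_n, forall k, a' k = a (u k) /\ b' k = b (u k).
Proof.
move=> hn ab ab' bi bi' /funext e.
have [j [s [thr thj s_inj sj sE]]] := row_normal_form hn ab bi.
have [j' [s' [thr' thj' s'_inj sj' sE']]] := row_normal_form hn ab' bi'.
have ej : j = j'.
  have {}thj' : supp_on (theta a b : 'I_p.+1 * 'I_q.+1 -> R) (inr j').
    by move=> c cj; rewrite e; exact: thj'.
  exact: (@supp_on_row _ _ _ (mk_rook thr)).
have [|u uE] :=
  @missing_relabel _ _ (card_cells hn) s s' (ord_max, j) s_inj s'_inj sj.
  by rewrite ej.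
exists u => k; have [-> ->] := sE' k; have [-> ->] := sE (u k).
by rewrite -uE e.
Qed.

(** Weights supported on a row and on a column are those of a vertex, so all shifts are integers. *)
Lemma row_column (R : realType) (p q n : nat) (a b : 'I_n -> R) (i : 'I_p.+1) :
  (p.+1 * q.+1)%N = n.+1 -> packed p q a b ->
  (forall k, b k = (round false (b k))%:R) ->
  supp_on (theta a b : 'I_p.+1 * 'I_q.+1 -> R) (inl i) ->
  forall k, a k = (round false (a k))%:R.
Proof.
move=> hn ab bi thi k.
have [j [s [thr thj s_inj sj sE]]] := row_normal_form hn ab bi.
have thE : theta a b = wt (vtx (i, j) : rook R p.+1 q.+1).
  exact: (congr1 wt (@supp_on_vtx _ _ _ (mk_rook thr) i j thi thj)).
have [-> _] := sE k; rewrite thE.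
rewrite (_ : shift _ _ _ = (\sum_(m < p.+1 | (m <= (s k).1)%N)
  ((m, (s k).2) == (i, j)))%N%:R); last by rewrite natr_sum.
by rewrite -natrD round_nat.
Qed.

Lemma row_exists (R : realType) (p q n : nat) (w : rook R p.+1 q.+1) j :
  (p.+1 * q.+1)%N = n.+1 -> supp_on (wt w) (inr j) ->
  exists a b : 'I_n -> R, packed p q a b /\ forall c, theta a b c = wt w c.
Proof.
move=> hn wj; have [s s_inj sj] := missing_exists (card_cells hn) (ord_max, j).
exists (square_x w s), (square_y s); split; first exact: squares_packed wj s_inj sj.
exact: (theta_squares hn wj s_inj sj).
Qed.

Lemma swap_rook_set (R : realType) (p q : nat) (w : 'I_p * 'I_q -> R) :
  rook_set w -> rook_set (fun c : 'I_q * 'I_p => w (c.2, c.1)).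
Proof.
move=> [w0 w1 [L wL]]; split=> //.
  rewrite -w1 -(pair_bigA _ (fun j i => w (i, j))) /= exchange_big /=.
  by rewrite pair_bigA /=; apply: eq_bigr => -[].
by case: L wL => k wL; [exists (inr k)|exists (inl k)]; move=> c ck; exact: wL.
Qed.

Lemma squares_exist (R : realType) (p q n : nat) (w : rook R p.+1 q.+1) :
  (p.+1 * q.+1)%N = n.+1 ->
  exists a b : 'I_n -> R, packed p q a b /\ forall c, theta a b c = wt w c.
Proof.
move=> hn; have [[i|j] wL] := wt_supp w; last exact: row_exists wL.
have wL' : supp_on (wt (mk_rook (swap_rook_set (set_valP w)))) (inr i).
  by move=> c ck; exact: wL.
have [b [a [ba th]]] := row_exists (card_cells_swap hn) wL'.
exists a, b; split; first exact: packed_swap.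
by case=> i' j'; rewrite -theta_swap th.
Qed.

Lemma theta_rook_set (R : realType) (p q n : nat) (a b : 'I_n -> R) :
  (p.+1 * q.+1)%N = n.+1 -> packed p q a b ->
  rook_set (theta a b : 'I_p.+1 * 'I_q.+1 -> R).
Proof.
move=> hn ab; have [ai|bi] := rigid hn ab; last first.
  by have [j [s []]] := row_normal_form hn ab bi.
have [j [s [/swap_rook_set th _ _ _ _]]] :=
  row_normal_form (card_cells_swap hn) (packed_swap ab) ai.
rewrite (_ : theta a b = fun c : 'I_p.+1 * 'I_q.+1 => theta b a (c.2, c.1)) //.
by apply/funext => -[i j']; rewrite theta_swap.
Qed.

(** If one configuration is aligned in columns and the other in rows, the common weights lie on a
    column, so by [row_column] the second is aligned in columns too. *)
Lemma squares_relabel (R : realType) (p q n : nat) (a b a' b' : 'I_n -> R) :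
  (p.+1 * q.+1)%N = n.+1 -> packed p q a b -> packed p q a' b' ->
  (forall c : 'I_p.+1 * 'I_q.+1, theta a b c = theta a' b' c) ->
  exists u : 'S_n, forall k, a' k = a (u k) /\ b' k = b (u k).
Proof.
move=> hn ab ab' e.
have hn' := card_cells_swap hn.
have e' : forall c : 'I_q.+1 * 'I_p.+1, theta b a c = theta b' a' c.
  by case=> j i; rewrite theta_swap e theta_swap.
have both_col : (forall k, a k = (round false (a k))%:R) ->
    (forall k, a' k = (round false (a' k))%:R) ->
    exists u : 'S_n, forall k, a' k = a (u k) /\ b' k = b (u k).
  move=> ai ai'.
  have [u uE] := row_relabel hn' (packed_swap ab) (packed_swap ab') ai ai' e'.
  by exists u => k; have [] := uE k.
have col (x y : 'I_n -> R) : packed p q x y ->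
    (forall k, x k = (round false (x k))%:R) ->
    exists i, supp_on (theta x y : 'I_p.+1 * 'I_q.+1 -> R) (inl i).
  move=> xy xi.
  have [i [s [_ thi _ _ _]]] := row_normal_form hn' (packed_swap xy) xi.
  by exists i => -[i' j] ij; rewrite -theta_swap thi.
have [ai|bi] := rigid hn ab; have [ai'|bi'] := rigid hn ab'.
- exact: both_col.
- have [i thi] := col a b ab ai.
  apply: both_col => //; apply: (row_column hn ab' bi' (i := i)).
  by move=> c ci; rewrite -e thi.
- have [i thi] := col a' b' ab' ai'.
  apply: both_col => //; apply: (row_column hn ab bi (i := i)).
  by move=> c ci; rewrite e thi.
- exact: row_relabel hn ab ab' bi bi' e.
Qed.

(** * The homeomorphism between UC and the complex *)

Section unlabelled_configurations.
Context (R : realType) (p q n : nat).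
Hypothesis hn : (p.+1 * q.+1)%N = n.+1.
Local Open Scope quotient_scope.
Local Notation config := (config R n p.+1 q.+1).
Local Notation UC := (UC R n p.+1 q.+1).
Local Notation rook := (rook R p.+1 q.+1).

(* The lower left corners of the squares. *)
Definition corner_x (c : config) (k : 'I_n) : R := (set_val c k).1 - 2^-1.
Definition corner_y (c : config) (k : 'I_n) : R := (set_val c k).2 - 2^-1.

Lemma config_packed c : packed p q (corner_x c) (corner_y c).
Proof.
have [bounds far] : @config_set R n p.+1 q.+1 (set_val c) := set_valP c.
rewrite /corner_x /corner_y; split=> [k|k|k l kl].
- by have [+ _] := bounds k; rewrite -[p.+1%:R]natr1; lra.
- by have [_] := bounds k; rewrite -[q.+1%:R]natr1; lra.
- have e (u v : R) : u - 2^-1 - (v - 2^-1) = u - v by ring.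
  by rewrite !e far.
Qed.

Lemma packed_config (a b : 'I_n -> R) : packed p q a b ->
  exists c : config, corner_x c = a /\ corner_y c = b.
Proof.
move=> [ha hb ab].
pose f k : R * R := (a k + 2^-1, b k + 2^-1).
have fP : @config_set R n p.+1 q.+1 f.
  split=> [k|k l kl] /=.
    by have := ha k; have := hb k; rewrite -[p.+1%:R]natr1 -[q.+1%:R]natr1; lra.
  have e (u v : R) : u + 2^-1 - (v + 2^-1) = u - v by ring.
  by rewrite !e ab.
exists (exist _ f (mem_set fP)).
by split; apply/funext => k; rewrite /corner_x /corner_y /= addrK.
Qed.

Definition weights (c : config) : rook :=
  mk_rook (theta_rook_set hn (config_packed c)).

Lemma proj_cont (k : 'I_n) :
  continuous (fun c : {ptws 'I_n -> (R * R)%type} => c k).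
Proof. exact: (@proj_continuous _ (fun=> (R * R)%type) k). Qed.

Lemma corner_x_cont k : continuous (fun c : config => corner_x c k).
Proof.
apply: addr_cont; last exact: cst_continuous.
apply: (comp_cont (g := fun c : {ptws 'I_n -> (R * R)%type} => (c k).1)).
  by apply: comp_cont; [exact: fst_cont|exact: proj_cont].
exact: set_val_cont.
Qed.

Lemma corner_y_cont k : continuous (fun c : config => corner_y c k).
Proof.
apply: addr_cont; last exact: cst_continuous.
apply: (comp_cont (g := fun c : {ptws 'I_n -> (R * R)%type} => (c k).2)).
  by apply: comp_cont; [exact: snd_cont|exact: proj_cont].
exact: set_val_cont.
Qed.

Lemma tent_cont (X : topologicalType) (u : X -> R) (v : R) :
  continuous u -> continuous (fun x => tent (u x - v)).
Proof.
move=> cu; apply: max_cont; first exact: cst_continuous.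
apply: onem_cont; apply: (comp_cont (g := fun x : R => `|x|)).
  exact: norm_continuous.
by apply: addr_cont => //; exact: cst_continuous.
Qed.

Lemma weights_cont : continuous weights.
Proof.
apply: rook_cont => c; rewrite /wt /= /theta; apply: onem_cont.
apply: sum_cont => k _; apply: mulr_cont; apply: tent_cont.
  exact: corner_x_cont.
exact: corner_y_cont.
Qed.

Lemma weights_relabelled c d : weights c = weights d <-> relabelled c d.
Proof.
split=> [e|/existsP[u /forallP cd]].
  have [|u uE] := squares_relabel hn (config_packed c) (config_packed d).
    by move=> x; exact: (congr1 (fun w => wt w x) e).
  apply/existsP; exists u; apply/forallP => k; apply/eqP.
  have [/addIr e1 /addIr e2] := uE k.
  by rewrite [LHS]surjective_pairing e1 e2 -surjective_pairing.
apply: wt_inj => x; rewrite /wt /= /theta; congr (_ - _).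
rewrite (reindex_inj (perm_inj (s := u))) /=; apply: eq_bigr => k _.
by rewrite /corner_x /corner_y (eqP (cd k)).
Qed.

Lemma UC_compact : compact [set: UC].
Proof.
have cK (m : nat) : compact [set x : R | 2^-1 <= x <= m%:R - 2^-1].
  rewrite (_ : [set x | _] = `[2^-1, m%:R - 2^-1]%classic).
    exact: segment_compact.
  by apply/seteqP; split=> x /=; rewrite in_itv.
have cc : compact (@config_set R n p.+1 q.+1).
  pose B : set {ptws 'I_n -> (R * R)%type} := [set c | forall k,
    ([set x : R | 2^-1 <= x <= p.+1%:R - 2^-1] `*`
     [set x : R | 2^-1 <= x <= q.+1%:R - 2^-1]) (c k)].
  have cB : compact B.
    apply: (@tychonoff _ (fun=> (R * R)%type) (fun=> _ `*` _)) => k.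
    exact: compact_setX.
  rewrite (_ : @config_set R n p.+1 q.+1 = B `&` [set c | forall k l, k != l ->
    1 <= Num.max `|(c k).1 - (c l).1| `|(c k).2 - (c l).2|]); last first.
    by apply/seteqP; split=> c [h1 h2].
  apply: compact_closedI => //.
  apply: closed_forall => k; apply: closed_forall => l.
  apply: closed_implies.
  apply: (@closed_comp _ _ (fun c : {ptws 'I_n -> (R * R)%type} =>
    Num.max `|(c k).1 - (c l).1| `|(c k).2 - (c l).2|) [set x | 1 <= x])
    => [c _|]; last exact: closed_ge.
  have dist_cont (f : R * R -> R) : continuous f ->
      continuous (fun c : {ptws 'I_n -> (R * R)%type} => `|f (c k) - f (c l)|).
    move=> cf; apply: (comp_cont (g := fun x : R => `|x|)).
      exact: norm_continuous.
    apply: addr_cont; first by apply: (comp_cont (g := f)) => //; exact: proj_cont.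
    rewrite (_ : (fun c => _) =
        fun c : {ptws 'I_n -> (R * R)%type} => -1 * f (c l) + 0).
      by apply: affine_cont; apply: (comp_cont (g := f)) => //; exact: proj_cont.
    by apply/funext => x; rewrite addr0 mulN1r.
  exact: (max_cont (dist_cont _ (@fst_cont R R)) (dist_cont _ (@snd_cont R R))).
rewrite (_ : [set: UC] = \pi_UC @` [set: config]).
  apply: continuous_compact; last exact: compact_set_type.
  by apply: continuous_subspaceT; exact: pi_continuous.
by apply/seteqP; split=> u // _; exists (repr u) => //; rewrite reprK.
Qed.

Lemma rook_hausdorff : hausdorff_space rook.
Proof.
move=> v w vw; apply: val_inj.
apply: (@hausdorff_product _ (fun=> R)); first by move=> _; exact: Rhausdorff.
move=> U V /(@set_val_cont _ (@rook_set R p.+1 q.+1) v) nU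
  /(@set_val_cont _ (@rook_set R p.+1 q.+1) w) nV.
by have [z [Uz Vz]] := vw _ _ nU nV; exists (set_val z).
Qed.

Lemma UC_homeo_rook : exists (f : UC -> rook) (g : rook -> UC),
  [/\ continuous f, continuous g, cancel f g & cancel g f].
Proof.
pose f (u : UC) : rook := weights (repr u).
have ex (w : rook) : exists c : config, weights c = w.
  have [a [b [ab th]]] := squares_exist w hn.
  have [c [cx cy]] := packed_config ab; exists c.
  by apply: wt_inj => x; rewrite -th -cx -cy.
(* The representative is chosen arbitrarily; [g] is continuous as the inverse of a continuous
   bijection from a compact space to a Hausdorff space. *)
pose g (w : rook) : UC := \pi_UC (projT1 (cid (ex w))).
have gE w : weights (projT1 (cid (ex w))) = w := projT2 (cid (ex w)).
have piE c d : \pi_UC c = \pi_UC d <-> relabelled c d.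
  by split=> [/eqmodP|cd]; [|apply/eqmodP].
have gK : cancel g f.
  by move=> w; rewrite -[RHS]gE; apply/weights_relabelled/piE; rewrite reprK.
have fK : cancel f g.
  move=> u; rewrite -[RHS]reprK; apply/piE/weights_relabelled; exact: gE.
have cf : continuous f.
  apply: repr_comp_continuous; first exact: weights_cont.
  by move=> c d /eqP /piE /weights_relabelled ->.
exists f, g; split=> //.
exact: (compact_hausdorff_inverse UC_compact rook_hausdorff cf).
Qed.

End unlabelled_configurations.

Theorem theorem1p2 (R : realType) (p q : nat) (hp : (2 <= p)%N)
    (hq : (2 <= q)%N) :
  (forall x : UC R (p * q - 1)%N p q,
      is_free_of_rank (braid_group x) ((p - 1) * (q - 1))%N) /\
  homotopy_equivalent R (UC R (p * q - 1)%N p q)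
    (wedge_of_circles R ((p - 1) * (q - 1))%N).
Proof.
case: p hp => [|[|p]] // _; case: q hq => [|[|q]] // _.
have hn : (p.+2 * q.+2)%N = (p.+2 * q.+2 - 1).+1 by rewrite subn1 prednK.
have [f [g [cf cg fK gK]]] := UC_homeo_rook R hn.
have -> : (p.+2 - 1)%N = p.+1 by rewrite subn1.
have -> : (q.+2 - 1)%N = q.+1 by rewrite subn1.
split=> [x|].
  by apply: (homeo_is_free_of_rank cf cg fK gK); exact: rook_is_free_of_rank.
by apply: (homeo_homotopy_equivalent cf cg fK gK); exact: rook_wedge_of_circles.
Qed.
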